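(* Any $m\in\mathbb{N}$ can be written as $x^2+y^2+z^2+w^2$ with $x,y,z\in\mathbb{N}/3$ and $w\in\mathbb{N}$ such that $x+y$ is an integer square.
   Context: $\mathbb{N}=\{0,1,2,\ldots\}$; $\mathbb{N}/3=\{k/3: k\in\mathbb{N}\}$; an integer square is an element of $\{t^2: t\in\mathbb{Z}\}$. *)

(* Defs.v *)
From mathcomp Require Import all_boot all_order all_algebra.

Set Implicit Arguments.
Unset Strict Implicit.
Unset Printing Implicit Defensive.

Import GRing.Theory.
Local Open Scope ring_scope.

Definition in_nat_thirds (q : rat) : Prop := exists k : nat, q = k%:R / 3%:R.

Definition is_int_square (q : rat) : Prop := exists t : int, q = (t ^+ 2)%:~R.

(* Main.v *)
From Stdlib Require Import NArith.
From mathcomp Require Import boolp classical_sets reals sequences exp.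
From mathcomp Require Rstruct.
Require Import Defs.
From mathcomp Require Import all_boot all_order all_algebra.
From mathcomp Require Import all_solvable all_field.
From mathcomp Require Import zify ring lra.

Set Implicit Arguments.
Unset Strict Implicit.
Unset Printing Implicit Defensive.

Import Order.TTheory GRing.Theory Num.Theory.
Local Open Scope ring_scope.

(** Put x + y = t^2 and x - y = A.  Then m = x^2 + y^2 + z^2 + w^2 becomes
    2m - t^4 = A^2 + 2z^2 + 2w^2 = A^2 + (z + w)^2 + (z - w)^2,
    and x, y >= 0 becomes A^2 <= t^4.  So it is enough to write 2m - t^4 as a
    sum of three squares A^2 + B^2 + C^2 with B and C of the same parity and
    A^2 <= t^4 ([thirds_rep_of_decomp]).  Among three integers two always have
    the same parity, hence any representation will do when m <= t^4 <= 2m; and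
    when all three have the same parity, A may be taken to be the smallest of
    them, and m/2 <= t^4 <= 2m suffices.  These intervals for t grow with m, so
    that for m large and not divisible by 16 they contain a t in a residue
    class for which 2m - t^4 is, up to a factor 16 or 4, congruent to 1 or 2
    modulo 4 or to 3 modulo 8.  Such numbers are sums of three squares, by the
    theorem of Legendre and Gauss.  Multiples of 16 follow by scaling all four
    numbers by 4, and the remaining small values of m by a finite search.  The
    witnesses found in this way are integers except for m = 7, 22, 31, 184,
    568 and 632 and products of these with powers of 16; this is where the
    denominator 3 comes in.

    The bulk of the file proves the three-square theorem ([three_squares]).  It
    is enough to treat squarefree n, and to represent n by three rational
    squares, since then Aubry's descent gives integers ([aubry]).  Choose a
    prime q congruent to 1 modulo 4 and put a = q (or a = 2q when n = 3 mod 8):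
    a is a sum of two rational squares, so it suffices to solve
    z^2 + a u^2 = n t^2.  This is Legendre's equation, solvable as soon as -a
    is a square modulo n and n is a square modulo a ([ternary_zero]).  The
    first condition prescribes the Legendre symbols (q / p) for the odd primes
    p dividing n, and quadratic reciprocity then turns the second one into a
    condition on q modulo 8.

    A prime q with prescribed symbols exists by an elementary form of
    Dirichlet's theorem restricted to characters with values in {-1, 0, 1}
    ([prime_with_characters]).  For such a character chi the sum of
    chi(n) Lambda(n) / n over n <= N is bounded, because L(1, chi) <> 0
    ([chi_harmonic_not_small], after Monsky) and by Chebyshev's bound, whereas
    for the principal character it tends to infinity.  Averaging over the
    characters gives the prime. *)

(** * Sums of periodic functions against monotone weights *)

Section PeriodicSums.
Variables (R : realFieldType) (M : nat) (chi : nat -> R).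
Hypotheses (M_gt0 : (0 < M)%N) (chi_per : forall n, chi (n + M)%N = chi n).
Hypotheses (chi_sum : \sum_(0 <= i < M) chi i = 0).
Hypotheses (chi_le1 : forall n, `|chi n| <= 1).

Lemma sum_window a : \sum_(a <= i < a + M) chi i = 0.
Proof.
elim: a => [|a IH]; first by rewrite add0n.
rewrite addSn big_nat_recr /=; last by lia.
by rewrite chi_per addrC -big_ltn //; lia.
Qed.

(** Whole periods cancel, so that only a remainder shorter than a period is
    left. *)
Lemma sum_periodic_bounded a b : `|\sum_(a <= i < b) chi i| <= M%:R.
Proof.
have [d] := ubnP (b - a)%N; elim: d a => // d IH a lt_d.
have [le_ab|lt_ab] := leqP (a + M) b; last first.
  apply: le_trans (ler_norm_sum _ _ _) _.
  apply: le_trans (ler_sum _ (fun i _ => chi_le1 i)) _.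
  by rewrite sumr_const_nat ler_nat; lia.
rewrite (big_cat_nat _ (n := a + M)) //=; last by lia.
by rewrite sum_window add0r; apply: IH; lia.
Qed.

(** Abel summation.  The bound involves the first weight alone, which is what
    makes sums against 1/n or (log n)/n converge. *)
Lemma sum_abel (w : nat -> R) a b :
    (forall n, (a <= n)%N -> 0 <= w n) ->
    (forall n, (a <= n)%N -> w n.+1 <= w n) ->
  `|\sum_(a <= i < b) chi i * w i| <= M%:R * w a.
Proof.
move=> w0 wS.
have [lt_ba|le_ab] := ltnP b a.
  by rewrite big_geq ?normr0 ?mulr_ge0 ?ler0n ?w0 // ltnW.
(* Telescoping: the step from b to b + 1 adds S(b + 1) * (w b - w b.+1),
   where S(b + 1) is a partial sum of chi. *)
have key : `|\sum_(a <= i < b) chi i * w i - (\sum_(a <= i < b) chi i) * w b|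
    <= M%:R * (w a - w b).
  rewrite -(subnKC le_ab); elim: (b - a)%N => [|d IH].
    by rewrite addn0 !big_geq // mul0r !subrr normr0 mulr0.
  rewrite addnS; have {le_ab} le_ab := leq_addr d a.
  move: (a + d)%N le_ab IH => {d}b le_ab IH.
  rewrite !big_nat_recr //=; set P := \sum_(_ <= _ < _) _ in IH *.
  set S := \sum_(_ <= _ < _) _ in IH *.
  have -> : P + chi b * w b - (S + chi b) * w b.+1 =
    (P - S * w b) + (S + chi b) * (w b - w b.+1) by ring.
  have -> : M%:R * (w a - w b.+1) =
    M%:R * (w a - w b) + M%:R * (w b - w b.+1) by ring.
  apply: le_trans (ler_normD _ _) _; apply: lerD => //.
  rewrite normrM (ger0_norm (x := w b - _)) ?subr_ge0 ?wS //.
  rewrite ler_wpM2r ?subr_ge0 ?wS //.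
  by have := sum_periodic_bounded a b.+1; rewrite big_nat_recr.
set P := \sum_(_ <= _ < _) _ in key *; set S := \sum_(_ <= _ < _) _ in key *.
have -> : P = (P - S * w b) + S * w b by ring.
have -> : M%:R * w a = M%:R * (w a - w b) + M%:R * w b by ring.
apply: le_trans (ler_normD _ _) _; apply: lerD => //.
rewrite normrM (ger0_norm (w0 _ le_ab)) ler_wpM2r ?w0 //.
exact: sum_periodic_bounded.
Qed.

End PeriodicSums.

(** Both sides run over the pairs (d, e) with d * e <= N. *)
Lemma sum_divisors_exchange (R : nmodType) (F : nat -> nat -> R) N :
  \sum_(1 <= n < N.+1) \sum_(1 <= d < N.+1 | (d %| n)%N) F d (n %/ d)%N =
  \sum_(1 <= d < N.+1) \sum_(1 <= e < (N %/ d).+1) F d e.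
Proof.
rewrite (exchange_big_dep_nat xpredT) //=; apply: eq_big_nat => d /andP[d_gt0 _].
rewrite [RHS](_ : _ = \sum_(1 <= e < N.+1 | (d * e <= N)%N) F d e); last first.
  rewrite [RHS](big_cat_nat _ (n := (N %/ d).+1)) //=; last first.
    by rewrite ?ltnS leq_div.
  rewrite [X in _ = _ + X]big_nat_cond [X in _ = _ + X]big1 ?addr0; last first.
    by move=> e /andP[/andP[]]; rewrite ltn_divLR // mulnC; lia.
  rewrite [RHS]big_mkcond; apply: eq_big_nat => e /andP[_].
  by rewrite ltnS leq_divRL // mulnC => ->.
pose s := [seq (d * e)%N | e <- index_iota 1 N.+1 & (d * e <= N)%N].
rewrite -big_filter -[RHS]big_filter.
rewrite (perm_big s); last first.
  apply: uniq_perm.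
  - by rewrite filter_uniq // iota_uniq.
  - rewrite map_inj_uniq ?filter_uniq ?iota_uniq // => x y /eqP.
    by rewrite eqn_pmul2l // => /eqP.
  move=> n; rewrite mem_filter mem_index_iota; apply/andP/mapP.
    case=> /dvdnP[e ->] /andP[n_gt0 n_lt]; exists e; last by rewrite mulnC.
    rewrite mem_filter mem_index_iota; nia.
  case=> e; rewrite mem_filter mem_index_iota => He ->.
  by rewrite dvdn_mulr //; split => //; nia.
by rewrite big_map; apply: eq_bigr => e _; rewrite mulKn.
Qed.

(** * Sums over divisors *)

Lemma big_divisors_nat (R : nmodType) (F : nat -> R) n N : (0 < n <= N)%N ->
  \sum_(d <- divisors n) F d = \sum_(1 <= d < N.+1 | (d %| n)%N) F d.
Proof.
move=> /andP[n_gt0 le_nN]; rewrite -[RHS]big_filter; apply: perm_big.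
apply: uniq_perm; rewrite ?divisors_uniq ?filter_uniq ?iota_uniq // => d.
rewrite -dvdn_divisors // mem_filter mem_index_iota.
case d_n: (d %| n)%N => //=; rewrite (dvdn_gt0 n_gt0 d_n) /=.
by rewrite ltnS (leq_trans (dvdn_leq n_gt0 d_n)).
Qed.

Lemma big_divisorsM (R : nmodType) (F : nat -> R) a b :
    (0 < a)%N -> (0 < b)%N -> coprime a b ->
  \sum_(d <- divisors (a * b)) F d =
  \sum_(d <- divisors a) \sum_(e <- divisors b) F (d * e)%N.
Proof.
move=> a_gt0 b_gt0 co_ab.
have ab_gt0 : (0 < a * b)%N by rewrite muln_gt0 a_gt0.
have gcdK d e : d \in divisors a -> e \in divisors b ->
    gcdn (d * e) a = d /\ gcdn (d * e) b = e.
  rewrite -!dvdn_divisors // => d_a e_b; split; apply/eqP.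
    rewrite gcdnC Gauss_gcdl ?(coprime_dvdr e_b) //.
    by rewrite gcdnC; apply/eqP/gcdn_idPl.
  rewrite gcdnC Gauss_gcdr; first by rewrite gcdnC; apply/eqP/gcdn_idPl.
  by rewrite coprime_sym (coprime_dvdl d_a).
rewrite (perm_big [seq (d * e)%N | d <- divisors a, e <- divisors b]) /=.
  by rewrite big_allpairs_dep.
apply: uniq_perm; first exact: divisors_uniq.
  apply: allpairs_uniq; try exact: divisors_uniq.
  move=> [d e] [d' e'] /allpairsP[[x y] /= [xa yb [-> ->]]].
  move=> /allpairsP[[x' y'] /= [xa' yb' [-> ->]]] eq_xy.
  have [ex ey] := gcdK _ _ xa yb; have [ex' ey'] := gcdK _ _ xa' yb'.
  rewrite /= in eq_xy.
  by congr (_, _); [rewrite -ex eq_xy ex' | rewrite -ey eq_xy ey'].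
move=> n; rewrite -dvdn_divisors //; apply/idP/allpairsP => [n_ab|[[d e]]] /=.
  exists (gcdn n a, gcdn n b); rewrite /= -!dvdn_divisors // !dvdn_gcdr.
  split=> //; apply/eqP; rewrite eqn_dvd; apply/andP; split.
    rewrite muln_gcdr !muln_gcdl !dvdn_gcd n_ab andbT.
    by rewrite dvdn_mull // dvdn_mull // dvdn_mulr.
  rewrite Gauss_dvd ?dvdn_gcdl //.
  exact: coprime_dvdl (dvdn_gcdr _ _) (coprime_dvdr (dvdn_gcdr _ _) co_ab).
by rewrite -!dvdn_divisors // => -[da eb ->]; apply: dvdn_mul.
Qed.

Lemma big_divisors_pfactor (R : nmodType) (F : nat -> R) p k : prime p ->
  \sum_(d <- divisors (p ^ k)) F d = \sum_(0 <= i < k.+1) F (p ^ i)%N.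
Proof.
move=> p_pr; have pk_gt0 : (0 < p ^ k)%N by rewrite expn_gt0 prime_gt0.
rewrite (perm_big [seq (p ^ i)%N | i <- index_iota 0 k.+1]).
  by rewrite big_map.
apply: uniq_perm; first exact: divisors_uniq.
  rewrite map_inj_uniq ?iota_uniq //; apply: expnI; exact: prime_gt1.
move=> n; rewrite -dvdn_divisors //; apply/idP/mapP => [|[i]].
  by case/(dvdn_pfactor _ _ p_pr) => i le_ik ->; exists i; rewrite ?mem_index_iota.
by rewrite mem_index_iota => /andP[_ lt_ik] ->; apply: dvdn_exp2l.
Qed.

(** Induction on the number of prime factors, one full prime power at a time:
    the form suited to multiplicative functions and to the logarithm. *)
Lemma coprime_pfactor_ind (P : nat -> Prop) :
    P 1%N ->
    (forall p k m, prime p -> coprime p m -> (0 < m)%N -> P m ->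
      P (p ^ k.+1 * m)%N) ->
  forall n, (0 < n)%N -> P n.
Proof.
move=> P1 PM n; have [N] := ubnP n; elim: N n => // N IH n lt_nN n_gt0.
have [n_gt1|] := ltnP 1 n; last by case: n n_gt0 {lt_nN} => [|[]].
have p_pr := pdiv_prime n_gt1; set p := pdiv n in p_pr.
have [m co_pm def_n] := pfactor_coprime p_pr n_gt0.
have : (0 < logn p n)%N by rewrite logn_gt0 mem_primes p_pr n_gt0 pdiv_dvd.
move: (logn p n) def_n => [|k] //; rewrite mulnC => def_n _.
have m_gt0 : (0 < m)%N by rewrite def_n muln_gt0 in n_gt0; case/andP: n_gt0.
rewrite def_n; apply: PM => //; apply: IH => //.
move: lt_nN; rewrite ltnS; apply: leq_trans.
have pk_gt1 : (1 < p ^ k.+1)%N by rewrite -(expn0 p) ltn_exp2l ?prime_gt1.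
by rewrite def_n -[X in (X < _)%N]mul1n ltn_pmul2r.
Qed.

Section RealCharacter.
Variables (R : realFieldType) (chi : nat -> R).
Hypothesis chi1 : chi 1%N = 1.
Hypothesis chiM : {morph chi : m n / (m * n)%N >-> m * n}.
Hypothesis chi_val : forall n, [\/ chi n = -1, chi n = 0 | chi n = 1].

Lemma chiX n k : chi (n ^ k)%N = chi n ^+ k.
Proof. by elim: k => [|k IH]; rewrite ?expn0 // expnS chiM IH exprS. Qed.

Definition chi_divsum n := \sum_(d <- divisors n) chi d.

Lemma chi_divsumM a b : (0 < a)%N -> (0 < b)%N -> coprime a b ->
  chi_divsum (a * b) = chi_divsum a * chi_divsum b.
Proof.
move=> a_gt0 b_gt0 co_ab; rewrite /chi_divsum big_divisorsM // mulr_suml.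
apply: eq_bigr => d _; rewrite mulr_sumr.
by apply: eq_bigr => e _; rewrite chiM.
Qed.

(** A geometric sum with ratio chi p, which is -1, 0 or 1. *)
Lemma chi_divsum_pfactor p k : prime p ->
  0 <= chi_divsum (p ^ k) /\ (~~ odd k -> 1 <= chi_divsum (p ^ k)).
Proof.
move=> p_pr; rewrite /chi_divsum big_divisors_pfactor //.
rewrite (eq_bigr (fun i => chi p ^+ i)) => [|i _]; last exact: chiX.
case: (chi_val p) => ->; last 2 first.
- rewrite big_nat_recl // big1 => [|i _]; last by rewrite exprS mul0r.
  by rewrite expr0 addr0 ler01.
- rewrite (eq_bigr (fun=> 1)) => [|i _]; last by rewrite expr1n.
  by rewrite sumr_const_nat subn0 ler0n ler1n.
have -> : \sum_(0 <= i < k.+1) (-1) ^+ i = (~~ odd k)%:R :> R.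
  elim: k => [|k IH]; first by rewrite big_nat1.
  rewrite big_nat_recr //= IH -signr_odd oddS.
  by case: (odd k); rewrite /= ?expr0 ?expr1; lra.
by case: (odd k); split.
Qed.

Lemma chi_divsum1 : chi_divsum 1 = 1.
Proof. by rewrite /chi_divsum big_seq1 chi1. Qed.

(** This positivity, special to real characters, is what will contradict
    L(1, chi) = 0. *)
Lemma chi_divsum_ge0 n : (0 < n)%N -> 0 <= chi_divsum n.
Proof.
elim/coprime_pfactor_ind: n / => [|p k m p_pr co_pm m_gt0 IH].
  by rewrite chi_divsum1.
rewrite chi_divsumM ?m_gt0 ?expn_gt0 ?prime_gt0 ?coprimeXl //.
by apply: mulr_ge0 => //; case: (chi_divsum_pfactor k.+1 p_pr).
Qed.

Lemma chi_divsum_sqr_ge1 n : (0 < n)%N -> 1 <= chi_divsum (n ^ 2).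
Proof.
elim/coprime_pfactor_ind: n / => [|p k m p_pr co_pm m_gt0 IH].
  by rewrite exp1n chi_divsum1.
rewrite expnMn -expnM chi_divsumM ?expn_gt0 ?m_gt0 ?prime_gt0 //; last first.
  by rewrite coprimeXl // coprimeXr.
have [_] := chi_divsum_pfactor (k.+1 * 2) p_pr.
by rewrite oddM andbF => /(_ isT) le1; rewrite -[1]mulr1 ler_pM.
Qed.

End RealCharacter.

(** * Nonvanishing of L(1, chi) for real characters *)

Section Monsky.
Variable R : realFieldType.
Implicit Types (r x d : R).

Lemma bernoulli_ge r n : 0 <= r <= 1 -> 1 - n%:R * (1 - r) <= r ^+ n.
Proof.
move=> /andP[r0 r1]; elim: n => [|n IH]; first by rewrite expr0 mul0r; lra.
rewrite exprS -natr1.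
have h1 := ler_wpM2l r0 IH; have a0 : 0 <= n%:R :> R by [].
have := mulr_ge0 a0 (sqr_ge0 (1 - r)).
move: n%:R (r ^+ n) h1 {IH a0} => a b *; lra.
Qed.

(** Quadratic growth is needed for the estimate of K * r^K in the proof that
    L(1, chi) <> 0; linear growth would not do. *)
Lemma binomial2_le x n : 0 <= x -> n%:R * (n%:R - 1) / 2 * x ^+ 2 <= (1 + x) ^+ n.
Proof.
move=> x0; elim: n => [|n IH]; first by rewrite expr0 mul0r; lra.
have lin : 1 + n%:R * x <= (1 + x) ^+ n.
  elim: n {IH} => [|n IH]; first by rewrite expr0 mul0r; lra.
  have a0 : 0 <= n%:R :> R by [].
  have h1 : 0 <= 1 + x by lra.
  have h2 := mulr_ge0 a0 (sqr_ge0 x); have := ler_wpM2l h1 IH.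
  rewrite exprS -natr1; move: n%:R (_ ^+ n) h2 {IH a0} => a b *; lra.
have h1 := ler_wpM2l x0 lin; rewrite [_ ^+ n.+1]exprS -natr1.
move: n%:R (_ ^+ n) IH h1 {lin} => a b *; lra.
Qed.

Definition geom r n : R := \sum_(0 <= i < n) r ^+ i.

Lemma geomE r n : 1 - r ^+ n = (1 - r) * geom r n.
Proof.
rewrite /geom; elim: n => [|n IH]; first by rewrite big_geq // mulr0 expr0 subrr.
by rewrite big_nat_recr //= mulrDr -IH exprS; ring.
Qed.

Lemma geomS r n : geom r n.+1 = geom r n + r ^+ n.
Proof. by rewrite /geom big_nat_recr. Qed.

Lemma geom_ge0 r n : 0 <= r -> 0 <= geom r n.
Proof. by move=> r0; apply: sumr_ge0 => i _; apply: exprn_ge0. Qed.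

Lemma geom_avg r n : 0 <= r <= 1 ->
  n.+1%:R * (2 - n%:R * (1 - r)) <= 2 * geom r n.+1.
Proof.
move=> r01; elim: n => [|n IH].
  by rewrite geomS /geom big_geq // expr0 mul0r; lra.
rewrite geomS; have := bernoulli_ge n.+1 r01.
move: IH; rewrite -[n.+2%:R]natr1 -[n.+1%:R]natr1.
move: n%:R (geom _ _) (_ ^+ _) => a b c *; nra.
Qed.

(** Passing from n to n + 1 multiplies the left side by r * (n + 2) / n and
    adds [geom r n.+1 * r ^+ n * (1 + r)] to the right side, so that the step
    comes down to a lower bound for the mean of 1, r, ..., r^n. *)
Lemma geom_mul_ge r n : 0 <= r <= 1 ->
  n%:R * n.+1%:R * r ^+ n <= geom r n * geom r n.+1.
Proof.
move=> r01; have /andP[r0 r1] := r01.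
elim: n => [|n IH]; first by rewrite mul0r mul0r mulr_ge0 ?geom_ge0.
have avg := geom_avg n r01.
have s0 := geom_ge0 n.+1 r0.
have c0 : 0 <= r ^+ n by rewrite exprn_ge0.
have a0 : 0 <= n%:R :> R by [].
have -> : geom r n.+1 * geom r n.+2 =
    geom r n * geom r n.+1 + geom r n.+1 * r ^+ n * (1 + r).
  by rewrite (geomS r n.+1) {2}(geomS r n) exprS; ring.
rewrite exprS -[n.+2%:R]natr1 -[n.+1%:R]natr1 in IH avg *.
suff : (n%:R + 1) * (2 * r - n%:R * (1 - r)) <= geom r n.+1 * (1 + r).
  move: {avg} n%:R (geom r n.+1) (r ^+ n) IH c0 a0 s0 => a s c IH c0 a0 s0 H.
  have H2 := ler_wpM2l c0 H; lra.
move: {IH c0} n%:R (geom r n.+1) avg s0 a0 => a s avg s0 a0.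
have d0 : 0 <= 1 - r by lra.
have a1 : 0 <= a + 1 by lra.
have ad := mulr_ge0 a0 d0; have a1d := mulr_ge0 a1 d0.
have [q0|q0] := leP 0 (2 - a * (1 - r)).
  have r2 : 0 <= 1 + r by lra.
  have h1 := ler_wpM2r r2 avg.
  have h2 : 0 <= 2 + a * (1 - r) by lra.
  have h3 := mulr_ge0 a1d h2; lra.
have r2 : 0 <= 1 + r by lra.
have h1 := mulr_ge0 s0 r2.
have h2 : 0 <= a * (1 - r) - 2 * r by lra.
have h3 := mulr_ge0 a1 h2; lra.
Qed.

(** The weights of Monsky's proof.  For fixed n both terms are unbounded as r
    tends to 1, but their difference decreases in n from the value 1, whatever
    r is. *)
Definition monsky r n : R := (n%:R * (1 - r))^-1 - r ^+ n / (1 - r ^+ n).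

Section Weight.
Variable r : R.
Hypothesis r01 : 0 < r < 1.

Let r0 : 0 < r. Proof. by case/andP: r01. Qed.
Let r1 : r < 1. Proof. by case/andP: r01. Qed.

Lemma geom_gt0 n : 0 < geom r n.+1.
Proof.
rewrite /geom big_nat_recl // expr0 ltr_pwDl ?ltr01 //.
by apply: sumr_ge0 => i _; rewrite exprn_ge0 ?ltW.
Qed.

Lemma monskyE n : monsky r n.+1 = (n.+1%:R^-1 - r ^+ n.+1 / geom r n.+1) / (1 - r).
Proof.
rewrite /monsky geomE; have := geom_gt0 n; move: (geom _ _) => g g0.
have n0 : n.+1%:R != 0 :> R by rewrite pnatr_eq0.
move: n.+1%:R n0 => a n0; field.
by rewrite n0 (lt0r_neq0 g0) subr_eq0 gt_eqF.
Qed.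

(** After clearing denominators this is [geom_mul_ge], because
    [geom r n.+1 - r * geom r n = 1]. *)
Lemma monsky_decr n : (0 < n)%N -> monsky r n.+1 <= monsky r n.
Proof.
case: n => // n _; rewrite !monskyE ler_pM2r ?invr_gt0 ?subr_gt0 //.
have g0 := geom_gt0 n; have g1 := geom_gt0 n.+1.
have n0 : 0 < n.+1%:R :> R by rewrite ltr0n.
have n1 : 0 < n.+2%:R :> R by rewrite ltr0n.
have key := @geom_mul_ge r n.+1; rewrite (ltW r0) (ltW r1) in key.
have {}key := key isT; rewrite -subr_ge0.
have -> : n.+1%:R^-1 - r ^+ n.+1 / geom r n.+1 -
   (n.+2%:R^-1 - r ^+ n.+2 / geom r n.+2) =
   (geom r n.+1 * geom r n.+2 - n.+1%:R * n.+2%:R * r ^+ n.+1) /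
   (n.+1%:R * n.+2%:R * (geom r n.+1 * geom r n.+2)).
  have e : geom r n.+2 - r * geom r n.+1 = 1.
    by rewrite geomS; have := geomE r n.+1; lra.
  have e' : n.+2%:R - n.+1%:R = 1 :> R by rewrite -natr1; ring.
  have -> : (geom r n.+1 * geom r n.+2 - n.+1%:R * n.+2%:R * r ^+ n.+1) =
    (n.+2%:R - n.+1%:R) * (geom r n.+1 * geom r n.+2) -
     (geom r n.+2 - r * geom r n.+1) * n.+1%:R * n.+2%:R * r ^+ n.+1.
    by rewrite e e'; ring.
  rewrite [r ^+ n.+2]exprS; move: {key e e'} (r ^+ n.+1) (geom r n.+1)
    (geom r n.+2) n.+1%:R n.+2%:R g0 g1 n0 n1 => c g g' a a' g0 g1 n0 n1.
  by field; rewrite !lt0r_neq0.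
by rewrite divr_ge0 ?subr_ge0 // !mulr_ge0 // ltW.
Qed.

Lemma monsky_ge0 n : (0 < n)%N -> 0 <= monsky r n.
Proof.
case: n => // n _; rewrite monskyE divr_ge0 ?(subr_ge0 r) ?(ltW r1) //.
have g0 := geom_gt0 n; have n0 : 0 < n.+1%:R :> R by rewrite ltr0n.
rewrite subr_ge0 ler_pdivrMr // mulrC ler_pdivlMr //.
rewrite /geom mulr_natr -[X in _ *+ X]subn0 -sumr_const_nat.
rewrite !big_nat; apply: ler_sum => i /andP[_ lt_in].
by apply: ler_wiXn2l; rewrite ?ltW // ltnW.
Qed.

Lemma monsky1 : monsky r 1 = 1.
Proof.
rewrite /monsky !expr1 mul1r; field.
by rewrite subr_eq0 eq_sym lt_eqF.
Qed.

Lemma sum_geom n J : (0 < n)%N -> \sum_(1 <= j < J.+1) r ^+ (n * j) =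
  (r ^+ n - r ^+ (n * J.+1)) / (1 - r ^+ n).
Proof.
move=> n_gt0; have rn : 1 - r ^+ n != 0.
  by rewrite subr_eq0 eq_sym lt_eqF // exprn_ilt1 ?ltW // -lt0n.
elim: J => [|J IH]; first by rewrite big_geq // muln1 subrr mul0r.
rewrite big_nat_recr //= IH [(n * J.+2)%N]mulnS exprD.
by move: (r ^+ n) (r ^+ (_ * _)) rn => a b rn; field.
Qed.

End Weight.

Variables (M : nat) (chi : nat -> R).
Hypotheses (M_gt0 : (0 < M)%N) (chi_per : forall n, chi (n + M)%N = chi n).
Hypotheses (chi_sum : \sum_(0 <= i < M) chi i = 0).
Hypothesis chi1 : chi 1%N = 1.
Hypothesis chiM : {morph chi : m n / (m * n)%N >-> m * n}.
Hypothesis chi_val : forall n, [\/ chi n = -1, chi n = 0 | chi n = 1].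

Lemma chi_norm_le1 n : `|chi n| <= 1.
Proof. by case: (chi_val n) => ->; rewrite ?normrN ?normr1 ?normr0. Qed.

Lemma divsum_squares_le r J : 0 <= r ->
  \sum_(1 <= k < J.+1) r ^+ (k ^ 2) <=
  \sum_(1 <= m < (J ^ 2).+1) chi_divsum chi m * r ^+ m.
Proof.
move=> r0; elim: J => [|J IH]; first by rewrite !big_geq.
rewrite big_nat_recr //= [X in _ <= X]big_nat_recr /=; last by rewrite expn_gt0.
apply: lerD; last first.
  by rewrite ler_peMl ?exprn_ge0 //; apply: chi_divsum_sqr_ge1.
apply: le_trans IH _.
rewrite [X in _ <= X](big_cat_nat _ (n := (J ^ 2).+1)) //=; last by nia.
rewrite lerDl big_nat; apply: sumr_ge0 => m /andP[m1 _].
by rewrite mulr_ge0 ?exprn_ge0 //; apply: chi_divsum_ge0 => //; lia.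
Qed.

(** Expanding r^n / (1 - r^n) would give the usual Lambert series.  Truncating
    each geometric series at n * j <= N makes the exchange of sums exact, so
    that no infinite series is involved. *)
Lemma lambert_chi r N :
  \sum_(1 <= m < N.+1) chi_divsum chi m * r ^+ m =
  \sum_(1 <= n < N.+1) chi n * \sum_(1 <= j < (N %/ n).+1) r ^+ (n * j).
Proof.
under [RHS]eq_bigr do rewrite mulr_sumr.
rewrite -(sum_divisors_exchange (fun n j => chi n * r ^+ (n * j))).
apply: eq_big_nat => m /andP[m_gt0 lt_mN].
rewrite /chi_divsum mulr_suml (big_divisors_nat _ (N := N)) ?m_gt0 //.
by apply: eq_bigr => d /divnK; rewrite mulnC => ->.
Qed.

(** The partial sums of chi(n)/n tend to L(1, chi) with an error at most
    M / (N + 1), so the bound refuted here is what L(1, chi) = 0 would mean.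
    Under this bound the sum of [chi_divsum chi m * r ^+ m] stays bounded as r
    tends to 1: by [lambert_chi] it is a multiple of a partial sum of
    chi(n)/n, minus a sum of chi against the decreasing weights [monsky r],
    minus a truncation error.  But its terms are nonnegative, and those at the
    squares are at least r^(k^2), whose sum is unbounded. *)
Lemma chi_harmonic_not_small :
  ~ (forall N, `|\sum_(1 <= n < N.+1) chi n / n%:R| <= M%:R / N.+1%:R).
Proof.
(* J / 2 exceeds the upper bound 2 M + 1 obtained below; 1 - r = 1 / (2 J^2)
   keeps r^(k^2) >= 1/2 for k <= J; and K is so large that the truncation at K
   costs at most 1. *)
move=> small; pose J := (4 * M + 3)%N; pose D := (2 * J ^ 2)%N.
pose K := (2 * D ^ 3 + 1)%N; pose d : R := D%:R^-1; pose r := 1 - d.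
have D_gt1 : (1 < D)%N by rewrite /D /J; nia.
have D0 : 0 < D%:R :> R by rewrite ltr0n; lia.
have d0 : 0 < d by rewrite invr_gt0.
have d1 : d < 1 by rewrite invf_lt1 // ltr1n.
have r01 : 0 < r < 1 by rewrite /r; lra.
have [r0 r1] := andP r01.
have K_gt0 : 0 < K%:R :> R by rewrite ltr0n /K addn1.
have rE : 1 - r = d by rewrite /r; ring.
have tail : K%:R * r ^+ K <= d.
  have P1 : r ^+ K * (1 + d) ^+ K <= 1.
    by rewrite -exprMn exprn_ile1 // /r; nra.
  have P2 := binomial2_le K (ltW d0).
  have K1 : K%:R - 1 = 2 * D%:R ^+ 3 :> R.
    by rewrite /K natrD natrM natrX addrK.
  have Dd : D%:R * d = 1 by rewrite mulfV ?lt0r_neq0.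
  have P3 : K%:R <= d * (1 + d) ^+ K.
    apply: le_trans (ler_wpM2l (ltW d0) P2); rewrite K1.
    have -> : d * (K%:R * (2 * D%:R ^+ 3) / 2 * d ^+ 2) =
      K%:R * (D%:R * d) ^+ 3 by field.
    by rewrite Dd expr1n mulr1.
  have rK0 : 0 <= r ^+ K by rewrite exprn_ge0 ?ltW.
  have := ler_wpM2r rK0 P3; move: (r ^+ K) ((1 + d) ^+ K) P1 => a b *; nra.
have lower : J%:R / 2 <= \sum_(1 <= m < K.+1) chi_divsum chi m * r ^+ m.
  rewrite (big_cat_nat _ (n := (J ^ 2).+1)) //=; last by rewrite /K /D /J; nia.
  rewrite -[X in X <= _]addr0; apply: lerD; last first.
    rewrite big_nat; apply: sumr_ge0 => m /andP[m1 _].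
    rewrite mulr_ge0 ?exprn_ge0 ?(ltW r0) //.
    by apply: chi_divsum_ge0 => //; apply: leq_trans m1.
  apply: le_trans (divsum_squares_le J (ltW r0)).
  have -> : J%:R / 2 = \sum_(1 <= k < J.+1) (1 / 2 : R).
    by rewrite sumr_const_nat subSS subn0 mul1r mulr_natl.
  rewrite !big_nat; apply: ler_sum => k /andP[_ lt_kJ].
  apply: (@le_trans _ _ (r ^+ (J ^ 2))); last first.
    by apply: ler_wiXn2l; rewrite ?ltW // leq_sqr -ltnS.
  have := @bernoulli_ge r (J ^ 2); rewrite (ltW r0) (ltW r1) rE => /(_ isT).
  apply: le_trans.
  have : D%:R * d = 1 by rewrite mulfV ?lt0r_neq0.
  by rewrite /D natrM; lra.
have upper : \sum_(1 <= m < K.+1) chi_divsum chi m * r ^+ m <= 2 * M%:R + 1.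
  rewrite lambert_chi.
  have -> : \sum_(1 <= n < K.+1) chi n * \sum_(1 <= j < (K %/ n).+1) r ^+ (n * j) =
      d^-1 * (\sum_(1 <= n < K.+1) chi n / n%:R) -
      \sum_(1 <= n < K.+1) chi n * monsky r n -
      \sum_(1 <= n < K.+1) chi n * (r ^+ (n * (K %/ n).+1) / (1 - r ^+ n)).
    rewrite mulr_sumr -!sumrB; apply: eq_big_nat => n /andP[n_gt0 _].
    rewrite sum_geom // /monsky rE mulrBl.
    by rewrite [in RHS]invfM; ring.
  have U1 : d^-1 * (\sum_(1 <= n < K.+1) chi n / n%:R) <= M%:R.
    rewrite invrK; apply: le_trans (ler_norm _) _.
    rewrite normrM gtr0_norm //; apply: le_trans (ler_wpM2l (ltW D0) (small K)) _.
    rewrite mulrA ler_pdivrMr ?ltr0n // -!natrM ler_nat.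
    by rewrite mulnC leq_mul2l; apply/orP; right; rewrite /K; nia.
  have U2 : - (\sum_(1 <= n < K.+1) chi n * monsky r n) <= M%:R.
    apply: le_trans (ler_norm _) _; rewrite normrN.
    have := sum_abel M_gt0 chi_per chi_sum chi_norm_le1 K.+1
      (monsky_ge0 r01) (monsky_decr r01).
    by rewrite monsky1 // mulr1.
  have U3 : - (\sum_(1 <= n < K.+1)
      chi n * (r ^+ (n * (K %/ n).+1) / (1 - r ^+ n))) <= 1.
    apply: le_trans (ler_norm _) _; rewrite normrN.
    apply: le_trans (ler_norm_sum _ _ _) _.
    apply: (@le_trans _ _ (\sum_(1 <= n < K.+1) r ^+ K / d)); last first.
      rewrite sumr_const_nat subSS subn0 -mulr_natl mulrA ler_pdivrMr //.
      by rewrite mul1r.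
    rewrite !big_nat; apply: ler_sum => n /andP[n_gt0 _].
    have rn1 : r ^+ n <= r by rewrite -[leRHS]expr1 ler_wiXn2l ?ltW.
    have rn2 : r ^+ (n * (K %/ n).+1) <= r ^+ K.
      by rewrite ler_wiXn2l ?ltW // mulnC ltnW // ltn_ceil.
    have x0 : 0 <= r ^+ (n * (K %/ n).+1) / (1 - r ^+ n).
      by rewrite divr_ge0 ?exprn_ge0 ?subr_ge0 ?(le_trans rn1) ?ltW.
    rewrite normrM (ger0_norm x0).
    apply: le_trans (ler_wpM2r x0 (chi_norm_le1 n)) _.
    rewrite mul1r; apply: ler_pM.
    + by rewrite exprn_ge0 ?ltW.
    + by rewrite invr_ge0 subr_ge0 (le_trans rn1) ?ltW.
    + by [].
    + by rewrite lef_pV2 ?posrE ?subr_gt0 ?(le_lt_trans rn1) // -rE lerB.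
  by lra.
have := le_trans lower upper; rewrite /J natrD natrM.
have : 0 <= M%:R :> R by [].
by lra.
Qed.

End Monsky.

(** * Von Mangoldt's function and Chebyshev's bound *)

Section Mangoldt.
Variable R : realType.

Definition mangoldt (m : nat) : R :=
  if size (primes m) == 1%N then ln (pdiv m)%:R else 0.

Lemma mangoldt_ge0 m : 0 <= mangoldt m.
Proof.
by rewrite /mangoldt; case: ifP => // _; rewrite ln_ge0 // ler1n pdiv_gt0.
Qed.

Lemma mangoldt_neq0 m : mangoldt m != 0 ->
  exists p k, [/\ prime p, (0 < k)%N & m = (p ^ k)%N].
Proof.
rewrite /mangoldt; case: ifP => [|_]; last by rewrite eqxx.
case E: (primes m) => [|p [|]] // _ _.
have : p \in primes m by rewrite E inE.
rewrite mem_primes => /and3P[p_pr m_gt0 p_m].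
exists p, (logn p m); split=> //; first by rewrite logn_gt0 mem_primes p_pr m_gt0.
by rewrite {1}(prod_prime_decomp m_gt0) prime_decompE E /= big_seq1.
Qed.

Lemma mangoldt1 : mangoldt 1 = 0.
Proof. by []. Qed.

Lemma mangoldt_pfactor p k : prime p -> mangoldt (p ^ k.+1) = ln p%:R.
Proof.
by move=> p_pr; rewrite /mangoldt primesX // primes_prime //= pdiv_pfactor.
Qed.

Lemma mangoldt_coprimeM m n : (1 < m)%N -> (1 < n)%N -> coprime m n ->
  mangoldt (m * n) = 0.
Proof.
move=> m_gt1 n_gt1 co_mn; rewrite /mangoldt; case: ifP => //.
case E: (primes (m * n)) => [|x []] //.
have pm := pdiv_prime m_gt1; have pn := pdiv_prime n_gt1.
have mn_gt0 : (0 < m * n)%N by rewrite muln_gt0 (ltnW m_gt1) (ltnW n_gt1).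
have : pdiv m \in primes (m * n).
  by rewrite mem_primes pm mn_gt0 dvdn_mulr // pdiv_dvd.
have : pdiv n \in primes (m * n).
  by rewrite mem_primes pn mn_gt0 dvdn_mull // pdiv_dvd.
rewrite E !inE => /eqP nE /eqP mE _.
have : (x %| gcdn m n)%N by rewrite dvdn_gcd -{1}mE -nE !pdiv_dvd.
by rewrite (eqP co_mn) dvdn1 -mE => /eqP pdE; rewrite pdE in pm.
Qed.

Lemma sum_mangoldt n : (0 < n)%N ->
  \sum_(d <- divisors n) mangoldt d = ln n%:R.
Proof.
elim/coprime_pfactor_ind: n / => [|p k m p_pr co_pm m_gt0 IH].
  by rewrite big_seq1 ln1.
have p0 : (0 : R) < p%:R by rewrite ltr0n prime_gt0.
rewrite big_divisorsM ?m_gt0 ?expn_gt0 ?prime_gt0 ?coprimeXl //.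
rewrite big_divisors_pfactor // big_nat_recl //= expn0.
under eq_bigr do rewrite mul1n.
rewrite IH natrM lnM ?posrE ?ltr0n ?m_gt0 ?expn_gt0 ?prime_gt0 // addrC.
congr (_ + _); rewrite natrX lnXn // -[X in _ *+ X]subn0 -sumr_const_nat.
apply: eq_bigr => i _.
rewrite (bigD1_seq 1%N) ?divisor1 ?divisors_uniq //= muln1 mangoldt_pfactor //.
rewrite big_seq_cond big1 ?addr0 // => d /andP[d_m d_n1].
rewrite -dvdn_divisors // in d_m.
apply: mangoldt_coprimeM; first by rewrite -(expn0 p) ltn_exp2l ?prime_gt1.
  by rewrite ltn_neqAle eq_sym d_n1 (dvdn_gt0 m_gt0 d_m).
by rewrite coprimeXl // (coprime_dvdr d_m).
Qed.

(** The logarithm is the divisor sum of [mangoldt].  Taking g = 1 gives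
    Chebyshev's bound, g = chi(n)/n the estimate of Mertens for chi, and the
    principal character its divergence. *)
Lemma sum_mult_ln (g : nat -> R) N : {morph g : m n / (m * n)%N >-> m * n} ->
  \sum_(1 <= n < N.+1) g n * ln n%:R =
  \sum_(1 <= m < N.+1) g m * mangoldt m * \sum_(1 <= e < (N %/ m).+1) g e.
Proof.
move=> gM; under [RHS]eq_bigr do rewrite mulr_sumr.
rewrite -(sum_divisors_exchange (fun m e => g m * mangoldt m * g e)).
apply: eq_big_nat => n /andP[n_gt0 lt_nN].
rewrite -sum_mangoldt // (big_divisors_nat _ (N := N)) ?n_gt0 // mulr_sumr.
apply: eq_bigr => d d_n; rewrite mulrAC -gM mulnC divnK //.
Qed.

Definition psi N := \sum_(1 <= m < N.+1) mangoldt m.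

Lemma psi_le M N : (M <= N)%N -> psi M <= psi N.
Proof.
move=> le_MN; rewrite /psi [leRHS](big_cat_nat _ (n := M.+1)) //=.
by rewrite lerDl sumr_ge0 // => m _; rewrite mangoldt_ge0.
Qed.

Lemma sum_ln_fact N : \sum_(1 <= n < N.+1) ln n%:R = ln (N`!)%:R :> R.
Proof.
elim: N => [|N IH]; first by rewrite big_geq // ln1.
by rewrite big_nat_recr //= IH factS mulnC natrM lnM // posrE ltr0n ?fact_gt0.
Qed.

Lemma ln_fact N : ln (N`!)%:R =
  \sum_(1 <= m < N.+1) mangoldt m * (N %/ m)%:R :> R.
Proof.
rewrite -sum_ln_fact; have := @sum_mult_ln (fun=> 1) N.
under eq_bigr do rewrite mul1r.
move=> -> => [|? ?]; last by rewrite mulr1.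
by apply: eq_bigr => m _; rewrite mul1r sumr_const_nat subSS subn0.
Qed.

Lemma central_bin_le N : ('C(N.*2, N) <= 2 ^ N.*2)%N.
Proof.
rewrite (_ : 2 = 1 + 1)%N // expnDn (bigD1 (inord N)) //= inordK; last by lia.
by rewrite !exp1n !muln1 leq_addr.
Qed.

Lemma ln2_le1 : ln 2 <= 1 :> R.
Proof. by have := @le_ln1Dx R 1; rewrite -[1 + 1]/2; apply; lra. Qed.

(** In the logarithm of the central binomial coefficient, expanded by [ln_fact],
    the term of an m in (N, 2N] is at least [mangoldt m], and no term is
    negative. *)
Lemma psi_double N : psi N.*2 - psi N <= N.*2%:R.
Proof.
apply: (@le_trans _ _ (ln ('C(N.*2, N))%:R)); last first.
  apply: (@le_trans _ _ (ln (2 ^ N.*2)%:R)).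
    by rewrite ler_ln ?posrE ?ltr0n ?expn_gt0 ?bin_gt0 -?addnn ?leq_addr //
      ler_nat addnn central_bin_le.
  by rewrite natrX lnXn // -[leLHS]mulr_natl ler_piMr // ln2_le1.
have -> : ln ('C(N.*2, N))%:R = ln (N.*2`!)%:R - ln (N`!)%:R - ln (N`!)%:R :> R.
  have le_N : (N <= N.*2)%N by rewrite -addnn leq_addr.
  have f0 k : (0 : R) < (k`!)%:R by rewrite ltr0n fact_gt0.
  rewrite -(bin_fact le_N) -addnn addnK mulnA !natrM !lnM ?posrE ?mulr_gt0 //.
  - by ring.
  - by rewrite ltr0n bin_gt0 leq_addr.
  - by rewrite ltr0n bin_gt0 leq_addr.
rewrite !ln_fact /psi.
have le_N : (N.+1 <= N.*2.+1)%N by rewrite ltnS -addnn leq_addr.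
have split_sum (F : nat -> R) : \sum_(1 <= m < N.*2.+1) F m =
    \sum_(1 <= m < N.+1) F m + \sum_(N.+1 <= m < N.*2.+1) F m.
  by rewrite (big_cat_nat _ (n := N.+1)).
rewrite !split_sum.
rewrite [leLHS]addrAC subrr add0r -!addrA addrCA -[leLHS]addr0.
apply: lerD; last first.
  rewrite addrA -!sumrB; apply: sumr_ge0 => m _.
  rewrite -!mulrBr mulr_ge0 ?mangoldt_ge0 // -addrA -opprD subr_ge0 -natrD ler_nat.
  case: m => [|m]; first by rewrite !divn0.
  by rewrite -addnn leq_divRL // mulnDl leq_add ?leq_divM.
rewrite !big_nat; apply: ler_sum => m /andP[lt_Nm lt_m].
rewrite ler_peMr ?mangoldt_ge0 // ler1n divn_gt0 //; lia.
Qed.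

Lemma chebyshev N : psi N <= 4 * N%:R.
Proof.
have [K] := ubnP N; elim: K N => // K IH N lt_NK.
have [N_gt1|N_le1] := ltnP 1 N; last first.
  case: N N_le1 {lt_NK} => [|[]] // _; first by rewrite /psi big_geq ?mulr_ge0.
  by rewrite /psi big_nat1 mangoldt1 mulr_ge0.
have [h [lt_hN hN1 hN2]] : exists h, [/\ (h < N)%N, (N <= h.*2)%N & (3 * h <= 2 * N)%N].
  (* h is N / 2 rounded up: psi N <= psi (2 h) <= psi h + 2 h <= 6 h <= 4 N *)
  by exists (N.+1 %/ 2)%N; rewrite -!muln2; split; lia.
have := IH h; rewrite (leq_trans lt_hN) // => /(_ isT) IHh.
have h1 := psi_le hN1; have h2 := psi_double h.
have h3 : 3 * h%:R <= 2 * N%:R :> R by rewrite -!natrM ler_nat.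
rewrite -[in X in _ <= X]addnn natrD in h2.
lra.
Qed.

(** A positive proportion of the n <= N are congruent to 1 modulo M, hence
    coprime to M, and most of them have a large logarithm.  By [sum_mult_ln]
    the sum of these logarithms is at most N times the sum in question. *)
Lemma coprime_mangoldt_unbounded M (B : R) : (0 < M)%N -> exists N,
  B < \sum_(1 <= m < N.+1) (coprime m M)%:R * mangoldt m / m%:R.
Proof.
move=> M_gt0; pose g n : R := (coprime n M)%:R.
have gM : {morph g : m n / (m * n)%N >-> m * n}.
  by move=> m n; rewrite /g coprimeMl; case: (coprime m M); case: (coprime n M);
    rewrite /= ?mulr0 ?mulr1.
have g_ge0 n : 0 <= g n by rewrite ler0n.
have [T [T_gt0 ltT]] : exists T : nat, (0 < T)%N /\ 2 * M%:R * (`|B| + 1) < ln T%:R.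
  pose x : R := expR (2 * M%:R * (`|B| + 1)).
  exists (Num.bound x); have xb : x < (Num.bound x)%:R.
    by rewrite archi_boundP // expR_ge0.
  have T0 : 0 < (Num.bound x)%:R :> R by rewrite (le_lt_trans (expR_ge0 _) xb).
  split; first by rewrite -(ltr0n R).
  by rewrite -(expRK (2 * _ * _)) ltr_ln ?posrE ?expR_gt0.
pose N := (M * T.*2)%N; exists N.
have N0 : 0 < N%:R :> R by rewrite ltr0n muln_gt0 M_gt0 double_gt0.
have ln_ge0' n : 0 <= ln n%:R :> R.
  by case: n => [|n]; [rewrite ln0 | rewrite ln_ge0 // ler1n].
have lower : N%:R * (`|B| + 1) <= \sum_(1 <= n < N.+1) g n * ln n%:R.
  have block K : \sum_(0 <= k < K) ln k%:R <=
      \sum_(1 <= n < (M * K).+1) g n * ln n%:R.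
    elim: K => [|K IH]; first by rewrite muln0 !big_geq.
    rewrite [leRHS](big_cat_nat _ (n := (M * K).+1)) //=; last first.
      by rewrite ltnS leq_mul2l leqnSn orbT.
    rewrite big_nat_recr //=; apply: lerD => //.
    rewrite big_ltn; last by rewrite ltnS ltn_mul2l M_gt0 /=.
    rewrite -[leLHS]addr0; apply: lerD; last first.
      by apply: sumr_ge0 => n _; rewrite mulr_ge0.
    have -> : g (M * K).+1 = 1.
      by rewrite /g -addn1 coprime_sym /coprime mulnC gcdnMDl gcdn1.
    case: K {IH} => [|K]; first by rewrite ln0 // mul1r.
    by rewrite mul1r ler_ln ?posrE ?ltr0n // ler_nat; nia.
  apply: le_trans (block T.*2).
  rewrite (big_cat_nat _ (n := T)) //=; last by rewrite -addnn leq_addr.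
  rewrite -[leLHS]add0r; apply: lerD; first by apply: sumr_ge0.
  apply: (@le_trans _ _ (\sum_(T <= k < T.*2) (2 * M%:R * (`|B| + 1)))).
    rewrite sumr_const_nat -addnn addnK -[leRHS]mulr_natl /N -addnn natrM natrD.
    by rewrite le_eqVlt; apply/orP; left; apply/eqP; ring.
  rewrite !big_nat; apply: ler_sum => k /andP[le_Tk _].
  by apply: le_trans (ltW ltT) _; rewrite ler_ln ?posrE ?ltr0n ?ler_nat ?(leq_trans T_gt0).
have upper : \sum_(1 <= n < N.+1) g n * ln n%:R <=
    N%:R * \sum_(1 <= m < N.+1) g m * mangoldt m / m%:R.
  rewrite sum_mult_ln // mulr_sumr !big_nat; apply: ler_sum => m /andP[m_gt0 _].
  have -> : N%:R * (g m * mangoldt m / m%:R) = g m * mangoldt m * (N%:R / m%:R).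
    by ring.
  rewrite ler_wpM2l ?mulr_ge0 ?mangoldt_ge0 //.
  apply: (@le_trans _ _ (N %/ m)%:R).
    apply: (@le_trans _ _ (\sum_(1 <= e < (N %/ m).+1) 1)).
      by apply: ler_sum => e _; rewrite /g; case: (coprime e M).
    by rewrite sumr_const_nat subSS subn0.
  by rewrite ler_pdivlMr ?ltr0n // -natrM ler_nat leq_divM.
have := le_trans lower upper; rewrite ler_pM2l //.
by apply: lt_le_trans; apply: le_lt_trans (ler_norm _) _; rewrite ltrDl.
Qed.

End Mangoldt.

Section BoundedCharacterSum.
Variables (R : realType) (M : nat) (chi : nat -> R).
Hypotheses (M_gt0 : (0 < M)%N) (chi_per : forall n, chi (n + M)%N = chi n).
Hypotheses (chi_sum : \sum_(0 <= i < M) chi i = 0).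
Hypothesis chi1 : chi 1%N = 1.
Hypothesis chiM : {morph chi : m n / (m * n)%N >-> m * n}.
Hypothesis chi_val : forall n, [\/ chi n = -1, chi n = 0 | chi n = 1].

Let chi_le1 := chi_norm_le1 chi_val.
Let A N : R := \sum_(1 <= n < N.+1) chi n / n%:R.

Lemma harmonic_cauchy m n : (m <= n)%N -> `|A n - A m| <= M%:R / m.+1%:R.
Proof.
move=> le_mn; rewrite /A (big_cat_nat _ (n := m.+1) (p := n.+1)) //=.
rewrite addrAC subrr add0r.
apply: (sum_abel M_gt0 chi_per chi_sum chi_le1 (w := fun n => n%:R^-1)) => k le_mk.
  by rewrite invr_ge0.
by rewrite lef_pV2 ?posrE ?ltr0n ?ler_nat // (leq_ltn_trans _ le_mk).
Qed.

(** L is L(1, chi).  The intervals of radius M / (n + 1) around the partial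
    sums meet pairwise, so the supremum of their left ends is in all of them. *)
Lemma harmonic_limit : exists L, forall n, `|A n - L| <= M%:R / n.+1%:R.
Proof.
pose E := [set A n - M%:R / n.+1%:R | n in [set: nat]]%classic.
have ub m : ubound E (A m + M%:R / m.+1%:R).
  move=> _ [n _ <-].
  have e k : 0 <= M%:R / k.+1%:R :> R by rewrite divr_ge0.
  have em := e m; have en := e n.
  have [le|/ltnW le] := leqP m n; have := harmonic_cauchy le;
    rewrite ler_norml; move: (A m) (A n) (_ / _) (_ / _) em en => *; lra.
have supE : has_sup E.
  by split; [exists (A 0 - M%:R / 1%:R), 0%N | exists (A 0 + M%:R / 1%:R)].
exists (sup E) => n; rewrite ler_norml; apply/andP; split.
  rewrite lerBrDl lerBlDr; apply: ge_sup; [by case: supE | exact: ub].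
rewrite lerBlDr -lerBlDl; apply: ub_le_sup; first by case: supE.
by exists n.
Qed.

(** The weight (log n)/n decreases from n = 4 on, since log 4 >= 1; the first
    three terms are bounded apart. *)
Lemma char_ln_bounded : exists B, forall N,
  `|\sum_(1 <= n < N.+1) chi n / n%:R * ln n%:R| <= B.
Proof.
pose w n : R := ln n%:R / n%:R.
have wE n : chi n / n%:R * ln n%:R = chi n * w n by rewrite /w; ring.
have w_ge0 n : 0 <= w n.
  by case: n => [|n]; rewrite /w ?invr0 ?mulr0 // divr_ge0 // ln_ge0 // ler1n.
exists (\sum_(1 <= n < 4) w n + M%:R * w 4%N) => N.
under eq_bigr do rewrite wE.
have part a b : `|\sum_(a <= n < b) chi n * w n| <= \sum_(a <= n < b) w n.
  apply: le_trans (ler_norm_sum _ _ _) _; apply: ler_sum => n _.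
  by rewrite normrM (ger0_norm (w_ge0 n)) ler_piMl.
have [lt_N4|le_4N] := ltnP N.+1 4.
  apply: le_trans (part _ _) _.
  rewrite (big_cat_nat _ (n := N.+1) (p := 4%N)) //=; last exact: ltnW.
  rewrite -addrA lerDl; apply: addr_ge0; first exact: sumr_ge0.
  by apply: mulr_ge0 => //; apply: w_ge0.
rewrite (big_cat_nat _ (n := 4%N)) //=.
apply: le_trans (ler_normD _ _) _; apply: lerD; first exact: part.
apply: (sum_abel M_gt0 chi_per chi_sum chi_le1) => n le_4n; first exact: w_ge0.
have n0 : 0 < n%:R :> R by rewrite ltr0n (leq_trans _ le_4n).
have lnn : 1 <= ln n%:R :> R.
  apply: (@le_trans _ _ (ln 4%:R)); last first.
    by rewrite ler_ln ?posrE // ler_nat.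
  rewrite (_ : 4%:R = 2 ^+ 2 :> R); last by ring.
  rewrite lnXn // mulr2n.
  have : ln (2^-1) <= - (1 / 2) :> R.
    rewrite [X in ln X](_ : _ = 1 + - (1 / 2)); last by field.
    by apply: le_ln1Dx; lra.
  by rewrite lnV ?posrE //; lra.
rewrite /w ler_pdivlMr // mulrAC ler_pdivrMr ?ltr0n //.
have -> : ln n.+1%:R = ln n%:R + ln (1 + n%:R^-1) :> R.
  rewrite -lnM ?posrE ?addr_gt0 ?invr_gt0 // mulrDr mulr1 mulfV ?lt0r_neq0 //.
  by rewrite natr1.
have : ln (1 + n%:R^-1) * n%:R <= 1 :> R.
  rewrite -ler_pdivlMr // div1r; apply: le_ln1Dx.
  by apply: lt_trans (_ : 0 < _); rewrite ?invr_gt0 // ltrN10.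
rewrite -natr1 mulrDl mulrDr; move: (ln (1 + _)) => *; lra.
Qed.

(** The bounded sum of chi(n) log(n) / n is the sum over m of
    chi(m) Lambda(m)/m times a partial sum of chi(e)/e over e <= N/m.
    Replacing the latter by L(1, chi) costs O(m/N) for each m, which adds up to
    a constant by Chebyshev's bound; then divide by L(1, chi). *)
Theorem char_mangoldt_bounded : exists B, forall N,
  `|\sum_(1 <= m < N.+1) chi m * mangoldt R m / m%:R| <= B.
Proof.
have [L HL] := harmonic_limit; have [B HB] := char_ln_bounded.
have L_neq0 : L != 0.
  apply/eqP => L0; apply: (chi_harmonic_not_small M_gt0 chi_per) => // N.
  by have := HL N; rewrite L0 subr0.
exists ((B + 4 * M%:R) / `|L|) => N.
rewrite ler_pdivlMr ?normr_gt0 // -normrM.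
set X := \sum_(_ <= _ < _) _.
have -> : X * L = \sum_(1 <= n < N.+1) chi n / n%:R * ln n%:R -
   \sum_(1 <= m < N.+1) chi m * mangoldt R m / m%:R * (A (N %/ m) - L).
  rewrite (@sum_mult_ln R (fun n => chi n / n%:R)); last first.
    by move=> m n; rewrite chiM natrM invfM; ring.
  rewrite -sumrB mulr_suml; apply: eq_bigr => m _; rewrite /A; ring.
apply: le_trans (ler_normB _ _) _; apply: lerD => //.
apply: le_trans (ler_norm_sum _ _ _) _.
case: N {X} => [|N]; first by rewrite big_geq // mulr_ge0.
have N0 : 0 < N.+1%:R :> R by rewrite ltr0n.
apply: (@le_trans _ _ (\sum_(1 <= m < N.+2) mangoldt R m * (M%:R / N.+1%:R))).
  rewrite !big_nat; apply: ler_sum => m /andP[m_gt0 _].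
  have m0 : 0 < m%:R :> R by rewrite ltr0n.
  have mg := mangoldt_ge0 R m.
  rewrite !normrM (ger0_norm mg) normfV (gtr0_norm m0) -!mulrA.
  apply: le_trans (ler_piMl _ (chi_le1 m)) _.
    by rewrite !mulr_ge0 // invr_ge0 ltW.
  apply: ler_wpM2l => //; rewrite mulrC ler_pdivrMr //.
  apply: le_trans (HL _) _.
  rewrite mulrAC ler_pdivlMr // mulrAC ler_pdivrMr ?ltr0n // -mulrA.
  apply: ler_wpM2l => //; rewrite -natrM ler_nat mulnC.
  by rewrite ltnW // ltn_ceil.
rewrite -mulr_suml mulrA ler_pdivrMr //.
have := chebyshev R N.+1; rewrite -/(psi R N.+1).
have : 0 <= M%:R :> R by [].
move: (psi R _) M%:R N.+1%:R {N0 HL HB} => p x y x0 h.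
have := ler_wpM2r x0 h; lra.
Qed.

End BoundedCharacterSum.

(** * Primes with prescribed values of real characters *)

Lemma periodic_modn (T : Type) (f : nat -> T) M n :
  (forall n, f (n + M)%N = f n) -> f (n %% M)%N = f n.
Proof.
move=> f_per; rewrite {2}(divn_eq n M) addnC.
elim: (n %/ M)%N => [|k IH]; first by rewrite addn0.
by rewrite mulSn addnCA addnC f_per.
Qed.

(** Multiplication by u permutes the residues modulo M. *)
Lemma sum_mul_unit (R : nmodType) (f : nat -> R) M u : (0 < M)%N ->
    (forall n, f (n + M)%N = f n) -> coprime u M ->
  \sum_(0 <= n < M) f (u * n)%N = \sum_(0 <= n < M) f n.
Proof.
case: M => // M _ f_per co_u; rewrite !big_mkord.
pose h (i : 'I_M.+1) : 'I_M.+1 := inord (u * i %% M.+1).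
have h_val i : h i = (u * i %% M.+1)%N :> nat by rewrite /h inordK ?ltn_pmod.
have h_inj : injective h.
  move=> i j /(congr1 val) /= /eqP; rewrite !h_val => eq_ij; apply/val_inj => /=.
  wlog le_ij : i j eq_ij / (i <= j)%N.
    move=> IH; have [|/ltnW] := leqP i j; first exact: IH.
    by move/(IH j i _) => -> //; rewrite eq_sym.
  move: eq_ij; rewrite eq_sym eqn_mod_dvd ?leq_mul2l ?le_ij ?orbT // -mulnBr.
  rewrite Gauss_dvdr 1?coprime_sym // => dvd_ij.
  have [|lt_ij] := posnP (j - i); first by lia.
  by have := dvdn_leq lt_ij dvd_ij; have := ltn_ord j; lia.
rewrite [RHS](reindex_inj h_inj); apply: eq_bigr => i _.
by rewrite h_val periodic_modn.
Qed.

(** By [sum_mul_unit] the sum is invariant under multiplication by [chi u]. *)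
Lemma sum_nonprincipal (R : idomainType) (chi : nat -> R) M u : (0 < M)%N ->
    {morph chi : m n / (m * n)%N >-> m * n} ->
    (forall n, chi (n + M)%N = chi n) -> coprime u M -> chi u != 1 ->
  \sum_(0 <= n < M) chi n = 0.
Proof.
move=> M_gt0 chiM chi_per co_u chi_u; set S := \sum_(_ <= _ < _) _.
have : S = chi u * S.
  rewrite -[LHS](sum_mul_unit M_gt0 chi_per co_u) mulr_sumr.
  by apply: eq_bigr => n _; rewrite chiM.
move/eqP; rewrite -subr_eq0 -{1}[S]mul1r -mulrBl mulf_eq0 subr_eq0 eq_sym.
by rewrite (negPf chi_u) => /eqP.
Qed.

Section PrescribedCharacters.
Variables (M r : nat) (ch : 'I_r -> nat -> int) (g : 'I_r -> int).
Hypothesis M_gt0 : (0 < M)%N.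
Hypothesis ch_per : forall i n, ch i (n + M)%N = ch i n.
Hypothesis ch1 : forall i, ch i 1%N = 1.
Hypothesis chM : forall i, {morph ch i : m n / (m * n)%N >-> m * n}.
Hypothesis ch_val : forall i n, coprime n M -> ch i n = 1 \/ ch i n = -1.
Hypothesis ch_dual : forall j, exists u,
  [/\ coprime u M, ch j u = -1 & forall i, i != j -> ch i u = 1].
Hypothesis g_val : forall i, g i = 1 \/ g i = -1.
Hypothesis g_nontrivial : exists j, g j = -1.

Section OverReals.
Variable R : realType.

Let chi (T : {set 'I_r}) (n : nat) : R :=
  (coprime n M)%:R * (\prod_(i in T) ch i n)%:~R.

Lemma chi_set1 T : chi T 1%N = 1.
Proof. by rewrite /chi coprime1n big1 ?mul1r. Qed.

Lemma chi_setM T : {morph chi T : m n / (m * n)%N >-> m * n}.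
Proof.
move=> m n; rewrite /chi coprimeMl -mulnb natrM.
under eq_bigr do rewrite chM.
by rewrite big_split /= intrM; ring.
Qed.

Lemma chi_set_per T n : chi T (n + M)%N = chi T n.
Proof.
rewrite /chi; under eq_bigr do rewrite ch_per.
by rewrite -coprime_modl modnDr coprime_modl.
Qed.

Lemma chi_set_val T n : [\/ chi T n = -1, chi T n = 0 | chi T n = 1].
Proof.
rewrite /chi; case co_n: (coprime n M); last first.
  by constructor 2; rewrite mul0r.
rewrite mul1r; have : \prod_(i in T) ch i n = 1 \/ \prod_(i in T) ch i n = -1.
  elim/big_ind: _ => [|x y [->|->] [->|->]|i _]; rewrite ?mulr1 ?mul1r ?mulN1r ?opprK; auto.
by case=> ->; [constructor 3 | constructor 1]; rewrite ?intrN.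
Qed.

Lemma chi_set_sum0 T : T != set0 -> \sum_(0 <= n < M) chi T n = 0.
Proof.
case/set0Pn=> j jT; have [u [co_u chj chi1]] := ch_dual j.
apply: (sum_nonprincipal M_gt0 (chi_setM T) (chi_set_per T) co_u).
rewrite /chi co_u mul1r (bigD1 j) //= chj big1 ?mulr1 => [|i /andP[_ /chi1] //].
by rewrite rmorphN1 -subr_eq0 -opprD oppr_eq0 (_ : 1 + 1 = 2%:R) // pnatr_eq0.
Qed.

(** The product of the [1 + g i * ch i m] vanishes unless m meets all the
    conditions.  Expanding it over the sets T of characters, summed against
    Lambda(m)/m, the nonempty T contribute bounded sums and the empty one an
    unbounded sum, so some prime power p^k meets all the conditions.  As some
    g j is -1, the exponent k is odd, and then p itself meets them. *)
Lemma prime_of_character_sums :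
  exists q, [/\ prime q, coprime q M & forall i, ch i q = g i].
Proof.
apply: contrapT => no_q.
pose gT (T : {set 'I_r}) : R := (\prod_(i in T) g i)%:~R.
have gT_norm T : `|gT T| = 1.
  have : \prod_(i in T) g i = 1 \/ \prod_(i in T) g i = -1.
    elim/big_ind: _ => [|x y [->|->] [->|->]|i _]; rewrite ?mulr1 ?mul1r ?mulN1r ?opprK; auto.
  by rewrite /gT; case=> ->; rewrite ?rmorphN1 ?normrN normr1.
have vanish m : (coprime m M)%:R * mangoldt R m *
    (\prod_i (1 + g i * ch i m))%:~R = 0.
  have [/eqP|L0] := boolP (mangoldt R m == 0); first by move->; rewrite mulr0 mul0r.
  have [p [k [p_pr k_gt0 def_m]]] := mangoldt_neq0 L0.
  case co_m: (coprime m M); last by rewrite !mul0r.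
  apply/eqP; rewrite mulf_eq0; apply/orP; right; rewrite intr_eq0.
  apply/negPn/negP => /prodf_neq0 nz; apply: no_q; exists p.
  have co_p : coprime p M by move: co_m; rewrite def_m coprime_pexpl.
  have chX i : ch i m = ch i p ^+ k.
    by rewrite def_m; elim: k {k_gt0 def_m} => [|k IH];
      rewrite ?expn0 // expnS chM IH exprS.
  have ch_m i : ch i m = g i.
    have := nz i isT; case: (g_val i) => ->; case: (ch_val i co_m) => ->;
      by rewrite // ?mulr1 ?mulN1r ?mul1r ?opprK ?subrr ?eqxx.
  have k_odd : odd k.
    have [j gj] := g_nontrivial; have := chX j; rewrite ch_m gj.
    case k_odd: (odd k) => // /eqP; rewrite -(odd_double_half k) k_odd add0n -mul2n exprM.
    by case: (ch_val j co_p) => ->; rewrite ?sqrrN !expr1n.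
  split=> // i; rewrite -ch_m chX.
  by case: (ch_val i co_p) => ->; rewrite ?expr1n // -signr_odd k_odd.
have sumB T : exists B, forall N, T != set0 ->
    `|\sum_(1 <= m < N.+1) chi T m * mangoldt R m / m%:R| <= B.
  have [->|T0] := eqVneq T set0; first by exists 0.
  have [B HB] := char_mangoldt_bounded M_gt0 (chi_set_per T) (chi_set_sum0 T0)
     (chi_set1 T) (@chi_setM T) (chi_set_val T).
  by exists B.
have [B HB] := fin_all_exists sumB.
have [N] := coprime_mangoldt_unbounded (\sum_(T | T != set0) B T) M_gt0.
apply/negP; rewrite -leNgt.
have -> : \sum_(1 <= m < N.+1) (coprime m M)%:R * mangoldt R m / m%:R =
    - \sum_(T | T != set0) gT T *
       \sum_(1 <= m < N.+1) chi T m * mangoldt R m / m%:R.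
  apply/eqP; rewrite -addr_eq0; apply/eqP.
  under [X in _ + X]eq_bigr do rewrite mulr_sumr.
  rewrite exchange_big /= -big_split /= big1 // => m _.
  have expand : \prod_i (1 + g i * ch i m) =
      \sum_(T : {set 'I_r}) (\prod_(i in T) g i) * \prod_(i in T) ch i m.
    under eq_bigr do rewrite addrC.
    rewrite bigA_distr; apply: eq_big => // T _.
    by rewrite -big_split /= [RHS]big_mkcond.
  have := vanish m; rewrite expand (bigD1 finset.set0) //= !big_set0 mulr1.
  move/(congr1 (fun x => x / m%:R)); rewrite mul0r => V; rewrite -[RHS]V.
  rewrite intrD mulrDr mulr1 mulrDl; congr (_ + _).
  rewrite rmorph_sum /= mulr_sumr mulr_suml; apply: eq_bigr => T _.
  by rewrite /gT /chi intrM; ring.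
rewrite -sumrN; apply: ler_sum => T T0.
apply: le_trans (ler_norm _) _; rewrite normrN normrM gT_norm mul1r.
exact: HB.
Qed.

End OverReals.

Import Rstruct.

Theorem prime_with_characters :
  exists q, [/\ prime q, coprime q M & forall i, ch i q = g i].
Proof. exact: (prime_of_character_sums Rdefinitions.R). Qed.

End PrescribedCharacters.

(** * The Legendre symbol *)

(** Euler's criterion, over the integers: the symbol is then multiplicative
    by construction, and is a power of a in every field of characteristic p. *)
Definition legendre (p : nat) (a : int) : int :=
  if (p %| a ^+ p.-1./2 - 1)%Z then 1 else if (p %| a)%Z then 0 else -1.

(** [chi4] and [chi8] give the Legendre symbols of -1 and 2 as functions of the
    prime; [legendreN1] and [legendre2] say so. *)
Definition chi4 (n : nat) : int :=
  if (n %% 4 == 1)%N then 1 else if (n %% 4 == 3)%N then -1 else 0.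

Definition chi8 (n : nat) : int :=
  if (n %% 8)%N \in [:: 1; 7]%N then 1 else if (n %% 8)%N \in [:: 3; 5]%N then -1 else 0.

(** Applied to 'F_p it yields square roots and nonresidues; applied to larger
    fields, the roots of unity of the Gauss sums. *)
Lemma finfield_primitive_root (F : finFieldType) (d : nat) :
  (d %| #|F|.-1)%N -> exists z : F, d.-primitive_root z.
Proof.
move=> d_F; have F_gt1 := finNzRing_gt1 F; pose rs := [seq x <- enum F | x != 0].
have F1_gt0 : (0 < #|F|.-1)%N by rewrite -subn1 subn_gt0.
suff : has #|F|.-1.-primitive_root rs.
  by case/hasP => z _ z_prim; exists (z ^+ (#|F|.-1 %/ d)); apply: dvdn_prim_root.
apply: has_prim_root => //.
- apply/allP=> x; rewrite mem_filter => /andP[x0 _]; apply/unity_rootP.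
  by apply: (mulfI x0); rewrite -exprS prednK ?(ltnW F_gt1) // expf_card mulr1.
- by rewrite filter_uniq ?enum_uniq.
- rewrite /rs enumT -(cardC1 (0 : F)) cardE /enum_mem !size_filter.
  by rewrite (eq_count (a2 := fun x => x != 0)).
Qed.

Section Legendre.
Variable p : nat.
Hypotheses (p_pr : prime p) (p_odd : odd p).

Let p_gt2 : (2 < p)%N. Proof. exact: odd_prime_gt2. Qed.
Let p_half : (p = p.-1./2.*2.+1)%N.
Proof. by move: p_gt2 p_odd; lia. Qed.
Let p_pred : p.-1 = (p.-1./2 * 2)%N.
Proof. by move: p_gt2 p_odd; lia. Qed.

Lemma legendre_val a :
  [\/ legendre p a = -1, legendre p a = 0 | legendre p a = 1].
Proof.
by rewrite /legendre; case: ifP => _; [constructor 3|case: ifP => _;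
  [constructor 2|constructor 1]].
Qed.

Lemma fermat_int (a : int) : ~~ (p %| a)%Z -> (p %| a ^+ p.-1 - 1)%Z.
Proof.
have pF := pchar_Fp p_pr; rewrite !(dvdz_pcharf pF) rmorphB rmorphXn /= => a0.
apply/eqP/(mulfI a0); rewrite mulr0 mulrBr -exprS prednK ?prime_gt0 //.
by rewrite -[X in _ ^+ X](card_Fp p_pr) expf_card mulr1 subrr.
Qed.

Lemma legendreP a : (p %| a ^+ p.-1./2 - legendre p a)%Z.
Proof.
rewrite /legendre; case: ifP => // not1; case: ifP => [p_a|/negbT p'a].
  rewrite subr0; have -> : p.-1./2 = p.-1./2.-1.+1 by move: p_gt2 p_odd; lia.
  by rewrite exprS dvdz_mulr.
have := fermat_int p'a; rewrite {1}p_pred exprM.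
rewrite (_ : _ - 1 = (a ^+ p.-1./2 - 1) * (a ^+ p.-1./2 - -1)); last by ring.
rewrite dvdzE abszM Euclid_dvdM // => /orP[h1|//].
by rewrite dvdzE h1 in not1.
Qed.

Lemma legendre_pchar (K : fieldType) a : p \in [pchar K] ->
  (legendre p a)%:~R = a%:~R ^+ p.-1./2 :> K.
Proof.
move=> pK; apply/esym/eqP; rewrite -subr_eq0 -rmorphXn -rmorphB /=.
by rewrite -(dvdz_pcharf pK) legendreP.
Qed.

(** Lifts identities between symbols from a field of characteristic p to the
    integers. *)
Lemma sign_pchar_inj (K : fieldType) (x y : int) : p \in [pchar K] ->
    [\/ x = -1, x = 0 | x = 1] -> [\/ y = -1, y = 0 | y = 1] ->
  x%:~R = y%:~R :> K -> x = y.
Proof.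
move=> pK hx hy /eqP; rewrite -subr_eq0 -rmorphB -(dvdz_pcharf pK) /=.
rewrite dvdzE /= => /dvdn_leq; move: p_gt2.
by case: hx => ->; case: hy => -> //= h1 /(_ isT) h2; move: (leq_trans h1 h2).
Qed.

Lemma legendreM a b : legendre p (a * b) = legendre p a * legendre p b.
Proof.
have pF := pchar_Fp p_pr; apply: (sign_pchar_inj pF (legendre_val _)).
  case: (legendre_val a) => ->; case: (legendre_val b) => ->;
  by rewrite ?mulr0 ?mul0r ?mulr1 ?mul1r ?mulrNN ?mulr1;
    by [constructor 1|constructor 2|constructor 3].
by rewrite intrM !(legendre_pchar _ pF) intrM exprMn.
Qed.

Lemma legendre_eqmod a b : (p %| a - b)%Z -> legendre p a = legendre p b.
Proof.
have pF := pchar_Fp p_pr; rewrite (dvdz_pcharf pF) rmorphB subr_eq0 => /eqP /= ab.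
apply: (sign_pchar_inj pF (legendre_val _) (legendre_val _)).
by rewrite !(legendre_pchar _ pF) ab.
Qed.

Lemma legendre1 : legendre p 1 = 1.
Proof. by rewrite /legendre expr1n subrr dvdz0. Qed.

Lemma legendre_eq0 a : (legendre p a == 0) = (p %| a)%Z.
Proof.
have pF := pchar_Fp p_pr; rewrite (dvdz_pcharf pF).
apply/eqP/eqP=> [l0|a0].
  have := legendre_pchar a pF; rewrite l0 => /esym/eqP.
  by rewrite expf_eq0 => /andP[_ /eqP].
apply: (sign_pchar_inj pF (legendre_val _)); first by constructor 2.
rewrite (legendre_pchar _ pF) a0 expr0n; case: eqP => // h0.
by move: p_gt2; rewrite p_half h0.
Qed.

(** The converse of Euler's criterion, from the cyclicity of the unit group. *)
Lemma legendre_sqr_root a : legendre p a = 1 -> exists x : int, (p %| x ^+ 2 - a)%Z.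
Proof.
have pF := pchar_Fp p_pr; have [|z z_prim] := @finfield_primitive_root 'F_p p.-1.
  by rewrite card_Fp.
move=> la; have := legendre_pchar a pF; rewrite la /= => /esym a_h.
have [i ai] : {i : 'I_p.-1 | a%:~R = z ^+ i}.
  apply: (prim_rootP z_prim); rewrite [X in _ ^+ X]p_pred exprM a_h.
  by rewrite expr1n.
move: a_h; rewrite ai -exprM => /eqP; rewrite -(prim_order_dvd z_prim).
have h0 : (0 < p.-1./2)%N by move: p_gt2 p_odd; lia.
rewrite {1}p_pred mulnC dvdn_pmul2r // => /dvdnP[j def_i].
exists (z ^+ j : 'F_p)%:Z; rewrite (dvdz_pcharf pF) rmorphB rmorphXn /= ai def_i.
by rewrite exprM -[_%:~R]/((z ^+ j : 'F_p)%:R) natr_Zp subrr.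
Qed.

Lemma legendre_nonresidue : exists u : nat, legendre p u = -1.
Proof.
have pF := pchar_Fp p_pr; have [|z z_prim] := @finfield_primitive_root 'F_p p.-1.
  by rewrite card_Fp.
have h0 : (0 < p.-1./2)%N by move: p_gt2 p_odd; lia.
have zE : ((z : nat)%:Z)%:~R = z by rewrite -[LHS]/((z : nat)%:R) natr_Zp.
exists z; case: (legendre_val z) => // lz; have := legendre_pchar (z : nat) pF.
  rewrite lz zE => /esym/eqP; rewrite expf_eq0 => /andP[_ /eqP z0].
  have := prim_expr_order z_prim; rewrite z0 expr0n => /eqP.
  have -> : (p.-1 == 0)%N = false by move: p_gt2; lia.
  by rewrite eq_sym oner_eq0.
rewrite lz zE => /esym/eqP; rewrite -(prim_order_dvd z_prim) => /dvdn_leq.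
by move/(_ h0); move: p_gt2 p_odd; lia.
Qed.

Lemma legendreN1 : legendre p (-1) = chi4 p.
Proof.
have pF := pchar_Fp p_pr.
apply: (sign_pchar_inj pF (legendre_val _)).
  by rewrite /chi4; case: ifP => _; [constructor 3|case: ifP => _; [constructor 1|constructor 2]].
rewrite (legendre_pchar _ pF) rmorphN1 -signr_odd /chi4.
have [h|h] : (p %% 4 = 1 /\ ~~ odd p.-1./2 \/ p %% 4 = 3 /\ odd p.-1./2)%N.
- by move: p_odd p_gt2; lia.
- by case: h => -> /negPf ->.
by case: h => -> ->.
Qed.

End Legendre.

(** * Quadratic reciprocity *)

Lemma sum_prim_root_exp (K : fieldType) q (z : K) k : q.-primitive_root z ->
  \sum_(0 <= a < q) z ^+ (a * k) = if (q %| k)%N then q%:R else 0.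
Proof.
move=> z_prim; rewrite big_mkord.
under eq_bigr do rewrite mulnC exprM.
rewrite (prim_order_dvd z_prim); case: ifP => [/eqP ->|/negbT zk].
  by under eq_bigr do rewrite expr1n; rewrite sumr_const card_ord.
have := subrX1 (z ^+ k) q; rewrite exprAC (prim_expr_order z_prim) expr1n subrr.
by move/esym/eqP; rewrite mulf_eq0 subr_eq0 (negPf zk) => /eqP.
Qed.

Lemma legendre_addp p : prime p -> odd p ->
  forall n : nat, legendre p (n + p)%N = legendre p n.
Proof.
by move=> p_pr p_odd n; apply: legendre_eqmod => //; rewrite PoszD addrC addKr dvdzz.
Qed.

Section Reciprocity.
Variables p q : nat.
Hypotheses (p_pr : prime p) (p_odd : odd p) (q_pr : prime q) (q_odd : odd q).
Hypotheses (neq_pq : p != q).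

Section GaussSum.
Variables (K : fieldType) (z : K).
Hypotheses (pK : p \in [pchar K]) (z_prim : q.-primitive_root z).

Let c (n : nat) : K := (legendre q n)%:~R.

Let cM m n : c (m * n)%N = c m * c n.
Proof. by rewrite /c PoszM legendreM // intrM. Qed.

Let c_per n : c (n + q)%N = c n.
Proof. by rewrite /c legendre_addp. Qed.

Let c_sqr n : c n ^+ 2 = (~~ (q %| n)%N)%:R.
Proof.
have := legendre_eq0 q_pr q_odd n; rewrite dvdzE /= => <-.
by rewrite /c -rmorphXn /=; case: (legendre_val q n) => ->.
Qed.

Let c_exp n : c n ^+ p = c n.
Proof.
rewrite /c -rmorphXn /=; congr (_%:~R).
case: (legendre_val q n) => ->; rewrite ?expr1n //.
  by rewrite -signr_odd p_odd.
by rewrite expr0n; case: p p_pr.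
Qed.

Let gauss : K := \sum_(0 <= a < q) c a * z ^+ a.

Let zq n : z ^+ (n + q) = z ^+ n.
Proof. by rewrite exprD (prim_expr_order z_prim) mulr1. Qed.

(** Raising to the power p is additive and maps z^a to z^(pa), while the
    symbols are fixed because p is odd. *)
Lemma gauss_frobenius : c p * gauss ^+ p = gauss.
Proof.
have -> : gauss ^+ p = \sum_(0 <= a < q) c a * z ^+ (p * a).
  rewrite -(pFrobenius_autE pK) rmorph_sum /=; apply: eq_bigr => a _.
  by rewrite pFrobenius_autE exprMn c_exp -exprM mulnC.
rewrite mulr_sumr; under eq_bigr do rewrite mulrA -cM.
apply: (sum_mul_unit (f := fun n => c n * z ^+ n)) => [|n|].
- exact: prime_gt0.
- by rewrite c_per zq.
- by rewrite prime_coprime // dvdn_prime2.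
Qed.

(** Substituting b = a t in the double sum over a and b leaves the inner sum
    of z^(a (1 + t)) over the nonzero a, which is q - 1 if t = -1 and -1
    otherwise. *)
Lemma gauss_sqr : gauss ^+ 2 = (legendre q (-1))%:~R * q%:R.
Proof.
have q_gt0 := prime_gt0 q_pr.
have c_sum : \sum_(0 <= t < q) c t = 0.
  have [u lu] := legendre_nonresidue q_pr q_odd.
  have co_u : coprime u q.
    rewrite coprime_sym prime_coprime //.
    by have := legendre_eq0 q_pr q_odd u; rewrite lu dvdzE /= => <-.
  have := @sum_nonprincipal int (fun n : nat => legendre q n) q u q_gt0.
  move=> H; rewrite /c -rmorph_sum H ?lu // => [m n|n].
    by rewrite PoszM legendreM.
  exact: legendre_addp.
have -> : gauss ^+ 2 =
    \sum_(0 <= a < q) \sum_(0 <= t < q) c a ^+ 2 * c t * z ^+ (a * t.+1).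
  rewrite expr2 {1}/gauss mulr_suml; apply: eq_big_nat => a /andP[_ lt_aq].
  rewrite /gauss mulr_sumr.
  have [q_a|a0] := boolP (q %| a)%N.
    have c0 : c a = 0 by apply/eqP; rewrite -sqrf_eq0 c_sqr q_a.
    by rewrite !big1 // => t _; rewrite c0 ?expr0n ?mul0r.
  rewrite -(sum_mul_unit (u := a) (f := fun b => c a * z ^+ a * (c b * z ^+ b))) //.
  - by apply: eq_bigr => t _; rewrite cM mulnS exprD; ring.
  - by move=> n; rewrite c_per zq.
  - by rewrite coprime_sym prime_coprime.
rewrite exchange_big_nat /=.
have inner t : \sum_(0 <= a < q) c a ^+ 2 * c t * z ^+ (a * t.+1) =
    c t * (if (q %| t.+1)%N then q%:R else 0) - c t.
  rewrite -(sum_prim_root_exp t.+1 z_prim) mulr_sumr.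
  rewrite (big_ltn q_gt0) [in RHS](big_ltn q_gt0).
  rewrite c_sqr dvdn0 /= mul0n expr0 !mul0r mulr1 add0r addrAC subrr add0r.
  apply: eq_big_nat => a /andP[a_gt0 lt_aq]; rewrite c_sqr gtnNdvd //.
  by rewrite mul1r.
under eq_bigr do rewrite inner.
rewrite sumrB c_sum subr0 -{1}(prednK q_gt0) big_nat_recr //= prednK // dvdnn.
rewrite big_nat big1 ?add0r => [|t /andP[_ lt_t]]; last first.
  by rewrite gtnNdvd ?mulr0 //; lia.
congr (_ * _); congr (_%:~R); apply: legendre_eqmod => //.
by rewrite opprK -PoszD addn1 prednK // dvdzz.
Qed.

End GaussSum.

(** In a field of characteristic p containing a primitive q-th root of unity,
    let G be the Gauss sum, with G^2 = q.  Its p-th power is (p / q) G by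
    [gauss_frobenius], and G (G^2)^((p - 1) / 2) = (q / p) G by Euler's
    criterion. *)
Lemma quadratic_reciprocity : (q %% 4 = 1)%N -> legendre p q = legendre q p.
Proof.
move=> q_mod4.
have [|K pK cardK] := @pPrimePowerField p q.-1 p_pr.
  by rewrite -subn1 subn_gt0 prime_gt1.
have [|z z_prim] := @finfield_primitive_root K q.
  rewrite cardK -subn1; have := @fermat_int q q_pr p.
  rewrite {1}dvdzE /= dvdn_prime2 // eq_sym neq_pq => /(_ isT).
  have -> : p%:Z ^+ q.-1 - 1 = (p ^ q.-1 - 1)%N%:Z.
    by rewrite -subzn ?expn_gt0 ?prime_gt0 // -[Posz (p ^ _)]natz natrX natz.
  by rewrite dvdzE.
set G := \sum_(0 <= a < q) (legendre q a)%:~R * z ^+ a.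
have sqG := gauss_sqr pK z_prim; have frG := gauss_frobenius pK z_prim.
rewrite -/G in sqG frG.
have q0 : q%:R != 0 :> K.
  by rewrite -(dvdn_pcharf pK) dvdn_prime2.
rewrite legendreN1 // /chi4 q_mod4 mul1r in sqG.
have G0 : G != 0 by apply: contraNneq q0 => G0; rewrite -sqG G0 expr0n.
have GE : G ^+ p = G * (legendre p q)%:~R.
  have p_half : p = (2 * p.-1./2).+1 by have := odd_prime_gt2 p_odd p_pr; lia.
  by rewrite {1}p_half exprS exprM sqG (legendre_pchar p_pr p_odd _ pK).
have prod1 : legendre q p * legendre p q = 1.
  apply: (sign_pchar_inj p_pr p_odd pK).
  - case: (legendre_val p q) => ->; case: (legendre_val q p) => -> /=;
    by [constructor 1|constructor 2|constructor 3].
  - by constructor 3.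
  rewrite intrM; apply: (mulfI G0); rewrite mulr1 -[RHS]frG GE.
  by ring.
move: prod1; case: (legendre_val p q) => ->; case: (legendre_val q p) => -> //.
Qed.

End Reciprocity.

(** The same argument as for reciprocity, with y = z + 1/z in place of the
    Gauss sum, where z is a primitive 8-th root of unity: y^2 = 2, and y^p
    depends on p modulo 8 only. *)
Lemma legendre2 p : prime p -> odd p -> legendre p 2 = chi8 p.
Proof.
move=> p_pr p_odd; have p_gt2 := odd_prime_gt2 p_odd p_pr.
have [|K pK cardK] := @pPrimePowerField p 2 p_pr; first by [].
have [|z z_prim] := @finfield_primitive_root K 8.
  rewrite cardK -subn1.
  have : (p %% 8 \in [:: 1; 3; 5; 7])%N by rewrite !inE; lia.
  rewrite !inE => h; apply/dvdnP.
  exists ((p ^ 2 - 1) %/ 8)%N; nia.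
have z4 : z ^+ 4 = -1.
  have : (z ^+ 4) ^+ 2 == 1 by rewrite -exprM (prim_expr_order z_prim).
  rewrite sqrf_eq1 => /orP[|/eqP //].
  by rewrite -(prim_order_dvd z_prim).
have two0 : 2%:R != 0 :> K.
  by rewrite -(dvdn_pcharf pK) gtnNdvd.
pose y := z + z ^+ 7.
have y2 : y ^+ 2 = 2%:R.
  have -> : y ^+ 2 = z ^+ 2 * (1 + z ^+ 4) ^+ 1 * 1 + z ^+ 4 * z ^+ 4 * 2%:R
     + z ^+ 2 * (z ^+ 4 * (z ^+ 8 - 1)) by rewrite /y; ring.
  by rewrite (prim_expr_order z_prim) z4; ring.
have y0 : y != 0 by apply: contraNneq two0 => y0; rewrite -y2 y0 expr0n.
apply: (sign_pchar_inj p_pr p_odd pK (legendre_val _ _)).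
  by rewrite /chi8; case: ifP => _; [constructor 3|case: ifP => _; [constructor 1|constructor 2]].
apply: (mulfI y0); rewrite (legendre_pchar p_pr p_odd _ pK) -[2%:~R]y2 -exprM -exprS.
rewrite (_ : (2 * p.-1./2).+1 = p); last by lia.
have -> : y ^+ p = z ^+ p + z ^+ (7 * p).
  by rewrite /y -(pFrobenius_autE pK) rmorphD /= !pFrobenius_autE -exprM.
rewrite -[z ^+ p](prim_expr_mod z_prim) -[z ^+ (7 * p)](prim_expr_mod z_prim).
rewrite -modnMmr /chi8.
have : (p %% 8 \in [:: 1; 3; 5; 7])%N by rewrite !inE; lia.
have z7 : z ^+ 7 = - z ^+ 3 by rewrite (exprD z 4 3) z4 mulN1r.
have z5 : z ^+ 5 = - z by rewrite (exprD z 4 1) z4 mulN1r.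
rewrite !inE /y => /or4P[] /eqP -> //=; rewrite ?z7 ?z5 ?expr1; ring.
Qed.

(** * Legendre's ternary equation and Aubry's descent *)

Lemma nat_sqrt n : exists k, (k ^ 2 <= n < k.+1 ^ 2)%N.
Proof.
elim: n => [|n [k /andP[le_kn lt_nk]]]; first by exists 0%N.
have [lt|ge] := ltnP n.+1 (k.+1 ^ 2); first by exists k; rewrite lt ltnW.
by exists k.+1; rewrite ge /=; nia.
Qed.

Lemma sqr_dist_le (k : nat) (i j : 'I_k.+1) :
  ((i : nat)%:Z - (j : nat)%:Z) ^+ 2 <= (k ^ 2)%N%:Z.
Proof.
have := ltn_ord i; have := ltn_ord j; move: (i : nat) (j : nat) => a b hj hi.
rewrite -[Posz (_ ^ _)]natz natrX -real_normK ?num_real // natz.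
have : `|a%:Z - b%:Z| <= k%:Z by lia.
by move=> h; rewrite ler_pXn2r // nnegrE.
Qed.

(** By the pigeonhole principle there is a nonzero (z, u, t) with z = r u
    modulo n, z = s t modulo a, and z^2 <= a n, u^2 <= n, t^2 < a.  Then
    V = z^2 + a u^2 - n t^2 is a multiple of a n greater than - a n and at most
    2 a n.  If V = 0 we are done.  If V = a n, multiply
    z^2 + a u^2 = n (t^2 + a) by t^2 + a and compose norms.  If V = 2 a n, all
    the inequalities are tight and n = u^2. *)
Lemma ternary_zero (a n : nat) (r s : int) : (0 < a)%N -> (0 < n)%N ->
    coprime a n -> (n %| r ^+ 2 + a%:Z)%Z -> (a %| s ^+ 2 - n%:Z)%Z ->
  exists z u t : int, t != 0 /\ z ^+ 2 + a%:Z * u ^+ 2 = n%:Z * t ^+ 2.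
Proof.
case: a n => // a' [] // n' _ _; set a := a'.+1; set n := n'.+1.
move=> co_an rP sP.
have [Z /andP[Z1 Z2]] := nat_sqrt (a * n).
have [U /andP[U1 U2]] := nat_sqrt n.
(* the root of a - 1, so that t^2 < a strictly: this excludes V = - a n *)
have [T /andP[T1 T2]] := nat_sqrt a'.
pose f (v : 'I_Z.+1 * 'I_U.+1 * 'I_T.+1) : 'I_n * 'I_a :=
  (inord `|((v.1.1 : nat)%:Z - r * (v.1.2 : nat)%:Z) %% n|%Z%N,
   inord `|((v.1.1 : nat)%:Z - s * (v.2 : nat)%:Z) %% a|%Z%N).
have f_notinj : ~~ injectiveb f.
  apply/negP => /injectiveP /leq_card; rewrite !card_prod !card_ord.
  apply/negP; rewrite -ltnNge -ltn_sqr !expnMn.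
  apply: (@leq_trans (a * n * n * a).+1); first by rewrite ltnS; nia.
  have lt1 : (a * n * n < Z.+1 ^ 2 * U.+1 ^ 2)%N by apply: ltn_mul.
  by apply: leq_trans (leq_mul lt1 T2); rewrite mulSn addSn ltnS leq_addl.
have [[[z1 u1] t1] [[[z2 u2] t2] neq_v eq_f]] := injectivePn f f_notinj.
pose z : int := (z1 : nat)%:Z - (z2 : nat)%:Z.
pose u : int := (u1 : nat)%:Z - (u2 : nat)%:Z.
pose t : int := (t1 : nat)%:Z - (t2 : nat)%:Z.
have modK (m' : nat) (x y : int) :
    inord `|(x %% m'.+1)%Z| = inord `|(y %% m'.+1)%Z| :> 'I_m'.+1 ->
    (m'.+1 %| x - y)%Z.
  have lt w : (`|(w %% m'.+1)%Z| < m'.+1)%N.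
    by rewrite -ltz_nat gez0_abs ?modz_ge0 // ltz_pmod.
  move/(congr1 val); rewrite /= !inordK //; move/(congr1 Posz).
  by rewrite !gez0_abs ?modz_ge0 // => /eqP; rewrite eqz_mod_dvd.
have [/modK n_zu /modK a_zt] : (f (z1, u1, t1)).1 = (f (z2, u2, t2)).1 /\
  (f (z1, u1, t1)).2 = (f (z2, u2, t2)).2 by rewrite eq_f.
rewrite /= in n_zu a_zt.
have {}n_zu : (n %| z - r * u)%Z.
  rewrite (_ : z - r * u = (z1 : nat)%:Z - r * (u1 : nat)%:Z -
    ((z2 : nat)%:Z - r * (u2 : nat)%:Z)) //; by rewrite /z /u; ring.
have {}a_zt : (a %| z - s * t)%Z.
  rewrite (_ : z - s * t = (z1 : nat)%:Z - s * (t1 : nat)%:Z -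
    ((z2 : nat)%:Z - s * (t2 : nat)%:Z)) //; by rewrite /z /t; ring.
have zZ : z ^+ 2 <= (a * n)%N%:Z.
  exact: le_trans (sqr_dist_le z1 z2) _.
have uU : u ^+ 2 <= n%:Z.
  exact: le_trans (sqr_dist_le u1 u2) _.
have tT : t ^+ 2 < a%:Z.
  exact: le_lt_trans (sqr_dist_le t1 t2) _.
have nz : [|| z != 0, u != 0 | t != 0].
  apply: contraNT neq_v; rewrite !negb_or !negbK => /and3P[z0 u0 t0].
  by move: z0 u0 t0;
    rewrite /z /u /t !subr_eq0 !eqz_nat !xpair_eqE -!val_eqE /= => -> -> ->.
pose V := z ^+ 2 + a%:Z * u ^+ 2 - n%:Z * t ^+ 2.
have n_V : (n %| V)%Z.
  have -> : V = (z - r * u) * (z + r * u) + (r ^+ 2 + a%:Z) * u ^+ 2 - n%:Z * t ^+ 2.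
    by rewrite /V; ring.
  by rewrite !rpredB ?rpredD // ?dvdz_mulr // dvdzz.
have a_V : (a %| V)%Z.
  have -> : V = (z - s * t) * (z + s * t) + (s ^+ 2 - n%:Z) * t ^+ 2 + a%:Z * u ^+ 2.
    by rewrite /V; ring.
  by rewrite !rpredD // ?dvdz_mulr // dvdzz.
have [k defV] : exists k, V = k * (a * n)%N%:Z.
  by apply/dvdzP; move: n_V a_V; rewrite !dvdzE /= Gauss_dvd // => -> ->.
have an0 : (0 : int) < (a * n)%N%:Z by [].
have a0 : (0 : int) < a%:Z by [].
have n0 : (0 : int) < n%:Z by [].
have auU : a%:Z * u ^+ 2 <= (a * n)%N%:Z by rewrite PoszM ler_pM2l.
have ntT : n%:Z * t ^+ 2 < (a * n)%N%:Z by rewrite mulnC PoszM ltr_pM2l.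
have ntT0 : 0 <= n%:Z * t ^+ 2 by rewrite mulr_ge0 ?sqr_ge0.
have auU0 : 0 <= a%:Z * u ^+ 2 by rewrite mulr_ge0 ?sqr_ge0.
have z0 := sqr_ge0 z.
have k_gtN1 : -1 < k.
  rewrite -(ltr_pM2r an0) mulN1r -defV /V.
  by clear -z0 auU0 ntT; lia.
have k_le2 : k <= 2.
  rewrite -(ler_pM2r an0) -defV /V.
  by clear -zZ auU ntT0; lia.
have : [\/ k = 0, k = 1 | k = 2].
  move: k_gtN1 k_le2; clear; case: k => [[|[|[|k]]]|k] //= _ _;
    by [constructor 1|constructor 2|constructor 3].
case=> k_val; rewrite k_val {k k_gtN1 k_le2 k_val} in defV.
- rewrite mul0r in defV; exists z, u, t; split; last first.
    by apply/eqP; rewrite -subr_eq0; apply/eqP.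
  apply/eqP => t0; move: nz; rewrite t0 eqxx orbF.
  have : z ^+ 2 + a%:Z * u ^+ 2 == 0.
    by rewrite -[X in _ == X]defV /V t0 expr0n mulr0 subr0.
  rewrite paddr_eq0 // [a%:Z * _ == 0]mulf_eq0 (gt_eqF a0) !sqrf_eq0 /=.
  by case/andP => -> ->.
- exists (z * t + a%:Z * u), (z - u * t), (t ^+ 2 + a%:Z); split.
    by rewrite gt_eqF // ltr_wpDl ?sqr_ge0.
  have h : z ^+ 2 + a%:Z * u ^+ 2 = n%:Z * (t ^+ 2 + a%:Z).
    apply/eqP; rewrite -subr_eq0 mulrDr opprD addrA -/V defV mul1r PoszM.
    by rewrite mulrC subrr.
  have -> : n%:Z * (t ^+ 2 + a%:Z) ^+ 2 =
      n%:Z * (t ^+ 2 + a%:Z) * (t ^+ 2 + a%:Z) by rewrite -mulrA.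
  by rewrite -h; ring.
exists u, 0, 1; split=> //.
have : a%:Z * u ^+ 2 = a%:Z * n%:Z.
  rewrite -PoszM; move: defV; rewrite /V.
  by clear -zZ auU ntT0; lia.
by move/(mulfI (lt0r_neq0 a0)) => ->; rewrite expr0n expr1n mulr0 addr0 mulr1.
Qed.

(** The line through the rational point (x, y, z) / t of the sphere and the
    integer point (x0, y0, z0) meets the sphere again, in a point with
    denominator a t + b. *)
Lemma aubry_step (n x y z t x0 y0 z0 : int) :
    n * t ^+ 2 = x ^+ 2 + y ^+ 2 + z ^+ 2 ->
  let a := x0 ^+ 2 + y0 ^+ 2 + z0 ^+ 2 - n in
  let b := 2 * (n * t - (x * x0 + y * y0 + z * z0)) in
  t * (a * t + b) = (x - t * x0) ^+ 2 + (y - t * y0) ^+ 2 + (z - t * z0) ^+ 2 /\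
  n * (a * t + b) ^+ 2 =
    (a * x + b * x0) ^+ 2 + (a * y + b * y0) ^+ 2 + (a * z + b * z0) ^+ 2.
Proof.
move=> H a b; split.
  have -> : (x - t * x0) ^+ 2 + (y - t * y0) ^+ 2 + (z - t * z0) ^+ 2 =
    (x ^+ 2 + y ^+ 2 + z ^+ 2) - 2 * t * (x * x0 + y * y0 + z * z0) +
    t ^+ 2 * (x0 ^+ 2 + y0 ^+ 2 + z0 ^+ 2) by ring.
  by rewrite -H /a /b; ring.
have -> : (a * x + b * x0) ^+ 2 + (a * y + b * y0) ^+ 2 + (a * z + b * z0) ^+ 2 =
    a ^+ 2 * (x ^+ 2 + y ^+ 2 + z ^+ 2) + 2 * a * b * (x * x0 + y * y0 + z * z0) +
    b ^+ 2 * (x0 ^+ 2 + y0 ^+ 2 + z0 ^+ 2) by ring.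
by rewrite -H /a /b; ring.
Qed.

Lemma nearest_int (x t : int) : 0 < t -> exists x0, 4 * (x - t * x0) ^+ 2 <= t ^+ 2.
Proof.
move=> t0; exists ((2 * x + t) %/ (2 * t))%Z.
have t20 : 2 * t != 0 by lia.
have := divz_eq (2 * x + t) (2 * t); have := modz_ge0 (2 * x + t) t20.
have := @ltz_pmod (2 * x + t) (2 * t); move: (_ %/ _)%Z (_ %% _)%Z => q m.
move=> h1 h2 h3; have {}h1 : m < 2 * t by apply: h1; lia.
have -> : 4 * (x - t * q) ^+ 2 = (2 * x - 2 * t * q) ^+ 2 by ring.
have -> : 2 * x - 2 * t * q = m - t by lia.
nia.
Qed.

(** Taking for (x0, y0, z0) an integer point nearest to (x, y, z) / t, the
    squared distance is at most 3/4, so that the denominator decreases. *)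
Lemma aubry (n x y z t : int) : 0 < t -> n * t ^+ 2 = x ^+ 2 + y ^+ 2 + z ^+ 2 ->
  exists x' y' z' : int, n = x' ^+ 2 + y' ^+ 2 + z' ^+ 2.
Proof.
have [N] := ubnP `|t|%N; elim: N x y z t => // N IH x y z t lt_tN t0 H.
have [x0 hx] := nearest_int x t0; have [y0 hy] := nearest_int y t0.
have [z0 hz] := nearest_int z t0.
have [] := aubry_step x0 y0 z0 H; set a := _ - n; set b := 2 * _; cbv zeta.
set t1 := a * t + b => H1 H2.
have t1_ge0 : 0 <= t1.
  have : 0 <= t * t1 by rewrite H1 !addr_ge0 ?sqr_ge0.
  by rewrite pmulr_rge0.
have lt_t1 : t1 < t.
  have h : 4 * (t * t1) <= 3 * t ^+ 2.
    rewrite H1; move: hx hy hz; clear.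
    move: (_ ^+ 2) (_ ^+ 2) (_ ^+ 2) (t ^+ 2) => *; lia.
  rewrite ltNge; apply/negP => le_t; have h2 := ler_wpM2l (ltW t0) le_t.
  have t2 : 0 < t * t by rewrite mulr_gt0.
  rewrite expr2 in h; move: (t * t) (t * t1) h h2 t2; clear=> *; lia.
have [t1_eq0|t1_neq0] := eqVneq t1 0; last first.
  apply: (IH _ _ _ t1 _ _ H2); last by rewrite lt_neqAle eq_sym t1_neq0.
  rewrite -ltnS; apply: leq_trans lt_tN; rewrite ltnS.
  by rewrite -ltz_nat !gez0_abs // ltW.
exists x0, y0, z0; move: H1; rewrite t1_eq0 mulr0 => /esym/eqP.
rewrite !paddr_eq0 ?addr_ge0 ?sqr_ge0 // !sqrf_eq0 !subr_eq0.
move=> /andP[/andP[/eqP xE /eqP yE] /eqP zE].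
apply: (mulIf (x := t ^+ 2)); first by rewrite sqrf_eq0 gt_eqF.
by rewrite H xE yE zE; ring.
Qed.

(** * Primes with prescribed Legendre symbols *)

Lemma chi4_modn n : chi4 (n %% 4) = chi4 n.
Proof. by rewrite /chi4 !modn_mod. Qed.

Lemma chi8_modn n : chi8 (n %% 8) = chi8 n.
Proof. by rewrite /chi8 !modn_mod. Qed.

Lemma chi4M m n : chi4 (m * n) = chi4 m * chi4 n.
Proof.
rewrite -chi4_modn -modnMm -[chi4 m]chi4_modn -[chi4 n]chi4_modn chi4_modn.
have := ltn_pmod m (isT : 0 < 4)%N; have := ltn_pmod n (isT : 0 < 4)%N.
by move: (m %% 4)%N (n %% 4)%N => [|[|[|[|?]]]] [|[|[|[|?]]]].
Qed.

Lemma chi8M m n : chi8 (m * n) = chi8 m * chi8 n.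
Proof.
rewrite -chi8_modn -modnMm -[chi8 m]chi8_modn -[chi8 n]chi8_modn chi8_modn.
have := ltn_pmod m (isT : 0 < 8)%N; have := ltn_pmod n (isT : 0 < 8)%N.
by move: (m %% 8)%N (n %% 8)%N => [|[|[|[|[|[|[|[|?]]]]]]]] [|[|[|[|[|[|[|[|?]]]]]]]].
Qed.

Lemma chi4_odd n : odd n -> chi4 n = 1 \/ chi4 n = -1.
Proof.
rewrite /chi4 => n_odd; have [->|->] : (n %% 4 = 1 \/ n %% 4 = 3)%N by lia.
  by left.
by right.
Qed.

Lemma chi8_odd n : odd n -> chi8 n = 1 \/ chi8 n = -1.
Proof.
rewrite /chi8 => n_odd.
have [->|[->|[->|->]]] : (n %% 8 = 1 \/ n %% 8 = 3 \/ n %% 8 = 5 \/ n %% 8 = 7)%N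
  by lia.
all: by [left | right].
Qed.

Lemma coprime_prod_seq (t : seq nat) n :
  coprime n (\prod_(p <- t) p) = all (coprime n) t.
Proof.
elim: t => [|p t IH] /=; first by rewrite big_nil coprimen1.
by rewrite big_cons coprimeMr IH.
Qed.

Section Keys.
Variable s : seq nat.
Hypotheses (s_uniq : uniq s) (s_pr : {in s, forall p, prime p && odd p}).

(** The conditions are indexed by distinct numbers: 4 and 8 stand for [chi4] and
    [chi8], and a prime for its Legendre symbol. *)
Let keys := 4%N :: 8%N :: s.
Let ch (k n : nat) : int :=
  if k == 4%N then chi4 n else if k == 8%N then chi8 n else legendre k n.
Let M := (8 * \prod_(p <- s) p)%N.

Lemma keys_uniq : uniq keys.
Proof.
rewrite /keys /= s_uniq andbT inE /=; apply/andP; split; apply/negP => /s_pr //.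
Qed.

Let s_key p : p \in s -> ch p =1 fun n : nat => legendre p n.
Proof.
move=> p_s n; rewrite /ch; have /andP[p_pr p_odd] := s_pr p_s.
by case: eqP p_odd => [->|_] //; case: eqP => [->|].
Qed.

Lemma prod_gt0 : (0 < \prod_(p <- s) p)%N.
Proof.
by rewrite big_seq; apply: prodn_cond_gt0 => p /s_pr /andP[/prime_gt0].
Qed.

Lemma M_gt0 : (0 < M)%N.
Proof. by rewrite muln_gt0 prod_gt0. Qed.

Lemma dvdn_prod_mem (t : seq nat) p : p \in t -> (p %| \prod_(r <- t) r)%N.
Proof. by move=> p_t; rewrite (big_rem p) //= dvdn_mulr. Qed.

Lemma ch_period k n : k \in keys -> ch k (n + M)%N = ch k n.
Proof.
rewrite !inE => /or3P[/eqP->|/eqP->|k_s].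
- have /eqP M4 : (4 %| M)%N by rewrite /M dvdn_mulr.
  by rewrite /ch /= -chi4_modn -modnDmr M4 addn0 chi4_modn.
- have /eqP M8 : (8 %| M)%N by rewrite /M dvdn_mulr.
  by rewrite /ch /= -chi8_modn -modnDmr M8 addn0 chi8_modn.
have /andP[p_pr p_odd] := s_pr k_s.
rewrite !s_key //; apply: legendre_eqmod => //.
rewrite PoszD addrC addKr dvdzE /= /M.
by rewrite dvdn_mull // dvdn_prod_mem.
Qed.

Lemma ch_morph k : k \in keys -> {morph ch k : m n / (m * n)%N >-> m * n}.
Proof.
rewrite !inE => /or3P[/eqP->|/eqP->|k_s] m n.
- exact: chi4M.
- exact: chi8M.
have /andP[p_pr p_odd] := s_pr k_s.
by rewrite !s_key // PoszM legendreM.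
Qed.

Lemma ch_one k : k \in keys -> ch k 1%N = 1.
Proof.
rewrite !inE => /or3P[/eqP->|/eqP->|k_s] //.
by rewrite s_key // legendre1.
Qed.

Lemma coprime_M n : coprime n M = odd n && all (coprime n) s.
Proof. by rewrite /M coprimeMr (coprime_pexpr (k := 3) n 2) // coprimen2 coprime_prod_seq. Qed.

Lemma legendre_coprime p n : p \in s -> coprime n p ->
  legendre p n = 1 \/ legendre p n = -1.
Proof.
move=> p_s co_np; have /andP[p_pr p_odd] := s_pr p_s.
have l0 : (legendre p n == 0) = false.
  rewrite legendre_eq0 // dvdzE /=; apply/negbTE.
  by rewrite -prime_coprime // coprime_sym.
case: (legendre_val p n) l0 => ->; rewrite ?eqxx //; by [right|left].
Qed.

Lemma ch_sign k n : k \in keys -> coprime n M -> ch k n = 1 \/ ch k n = -1.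
Proof.
rewrite coprime_M !inE => /or3P[/eqP->|/eqP->|k_s] /andP[n_odd /allP co_n].
- exact: chi4_odd.
- exact: chi8_odd.
by rewrite s_key //; apply: legendre_coprime => //; apply: co_n.
Qed.

Lemma legendre_mod1 p n : p \in s -> (n = 1 %[mod p])%N -> legendre p n = 1.
Proof.
move=> p_s n1; have /andP[p_pr p_odd] := s_pr p_s.
rewrite -(legendre1 p); apply: legendre_eqmod => //.
by rewrite -eqz_mod_dvd -[1]/(Posz 1) !modz_nat n1.
Qed.

Let P := (\prod_(p <- s) p)%N.

Lemma coprime_8_prod : coprime 8 P.
Proof.
rewrite coprime_sym (coprime_pexpr (k := 3) P 2) // coprime_sym /P coprime_prod_seq.
apply/allP => p /s_pr /andP[p_pr p_odd].
by rewrite coprime_sym coprimen2.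
Qed.

(** Independence of [chi4] and [chi8] from the symbols at the primes of s, by
    the Chinese remainder theorem. *)
Lemma exists_residue8 c : odd c -> exists u,
  [/\ coprime u M, chi4 u = chi4 c, chi8 u = chi8 c &
      forall p, p \in s -> legendre p (u : nat) = 1].
Proof.
move=> c_odd; pose u := chinese 8 P c 1.
have u8 : (u %% 8 = c %% 8)%N by apply: chinese_modl coprime_8_prod _ _.
have uP : (u %% P = 1 %% P)%N by apply: chinese_modr coprime_8_prod _ _.
have up p : p \in s -> (u = 1 %[mod p])%N.
  move=> p_s; have p_P : (p %| P)%N by apply: dvdn_prod_mem.
  by rewrite -(modn_dvdm u p_P) uP modn_dvdm.
exists u; split.
- rewrite coprime_M; apply/andP; split; first by lia.
  apply/allP => p p_s; rewrite -coprime_modl (up p p_s) coprime_modl.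
  exact: coprime1n.
- rewrite -chi4_modn -[RHS]chi4_modn; congr chi4.
  by rewrite -(modn_dvdm u (isT : 4 %| 8)%N) u8 modn_dvdm.
- by rewrite -chi8_modn u8 chi8_modn.
- by move=> p p_s; apply: legendre_mod1 => //; apply: up.
Qed.

(** Independence of the symbol at p from all the others, by the Chinese
    remainder theorem. *)
Lemma exists_nonresidue p : p \in s -> exists u,
  [/\ coprime u M, chi4 u = 1, chi8 u = 1, legendre p (u : nat) = -1 &
      forall p', p' \in s -> p' != p -> legendre p' (u : nat) = 1].
Proof.
move=> p_s; have /andP[p_pr p_odd] := s_pr p_s.
have [v lv] := legendre_nonresidue p_pr p_odd.
pose Q := (8 * \prod_(r <- rem p s) r)%N.
have s_neq r : r \in rem p s -> r \in s /\ r != p.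
  by rewrite mem_rem_uniq // inE => /andP[].
have co_pQ : coprime p Q.
  rewrite coprimeMr (coprime_pexpr (k := 3) p 2) // coprimen2 p_odd coprime_prod_seq.
  apply/allP => r /s_neq[r_s r_p]; have /andP[r_pr _] := s_pr r_s.
  by rewrite prime_coprime // dvdn_prime2 // eq_sym.
pose u := chinese p Q v 1.
have u_p : (u %% p = v %% p)%N by apply: chinese_modl co_pQ _ _.
have uQ : (u %% Q = 1 %% Q)%N by apply: chinese_modr co_pQ _ _.
have uQ' d : (d %| Q)%N -> (u = 1 %[mod d])%N.
  by move=> d_Q; rewrite -(modn_dvdm u d_Q) uQ modn_dvdm.
have u8 : (u = 1 %[mod 8])%N by apply: uQ'; rewrite dvdn_mulr.
have u_r r : r \in s -> r != p -> (u = 1 %[mod r])%N.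
  move=> r_s r_p; apply: uQ'; rewrite dvdn_mull // dvdn_prod_mem //.
  by rewrite mem_rem_uniq // inE r_p.
have lu : legendre p u = -1.
  rewrite -lv; apply: legendre_eqmod => //.
  by rewrite -eqz_mod_dvd !modz_nat u_p.
exists u; split=> //.
- rewrite coprime_M; apply/andP; split; first by lia.
  apply/allP => r r_s; have [->|r_p] := eqVneq r p.
    rewrite coprime_sym prime_coprime //.
    by have := legendre_eq0 p_pr p_odd u; rewrite lu dvdzE /= => <-.
  by rewrite -coprime_modl (u_r r) // coprime_modl coprime1n.
- by rewrite -chi4_modn -(modn_dvdm u (isT : 4 %| 8)%N) u8.
- by rewrite -chi8_modn u8.
- by move=> r r_s r_p; apply: legendre_mod1 => //; apply: u_r.
Qed.

Lemma ch_dual k : k \in keys -> exists u,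
  [/\ coprime u M, ch k u = -1 & forall k', k' \in keys -> k' != k -> ch k' u = 1].
Proof.
rewrite !inE => /or3P[/eqP->|/eqP->|k_s].
- have [u [co_u u4 u8 us]] := @exists_residue8 7 isT.
  exists u; split=> //= k'; rewrite !inE => /or3P[/eqP->|/eqP->|k_s] //.
  by rewrite s_key // us.
- have [u [co_u u4 u8 us]] := @exists_residue8 5 isT.
  exists u; split=> //= k'; rewrite !inE => /or3P[/eqP->|/eqP->|k_s] //.
  by rewrite s_key // us.
have [u [co_u u4 u8 uk us]] := exists_nonresidue k_s.
exists u; split=> //=; first by rewrite s_key.
move=> k'; rewrite !inE => /or3P[/eqP->|/eqP->|k'_s] // k'_k.
by rewrite s_key // us.
Qed.

Lemma prime_with_symbols_nontrivial (e8 : int) (e : nat -> int) p0 :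
    e8 = 1 \/ e8 = -1 -> {in s, forall p, e p = 1 \/ e p = -1} ->
    p0 \in s -> e p0 = -1 ->
  exists q, [/\ prime q, (q %% 4 = 1)%N, chi8 q = e8 &
    {in s, forall p, legendre p q = e p}].
Proof.
move=> e8_val e_val p0_s e_p0.
pose gk k : int := if k == 4%N then 1 else if k == 8%N then e8 else e k.
have kmem (i : 'I_(size keys)) : nth 0%N keys i \in keys by rewrite mem_nth.
have gk_s p : p \in s -> gk p = e p.
  move=> /s_pr /andP[_ p_odd]; rewrite /gk.
  by case: eqP p_odd => [->|_] //; case: eqP => [->|].
have gk_val k : k \in keys -> gk k = 1 \/ gk k = -1.
  rewrite !inE => /or3P[/eqP->|/eqP->|k_s]; first by left.
    exact: e8_val.
  by rewrite gk_s //; apply: e_val.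
have [] := @prime_with_characters M (size keys) (fun i => ch (nth 0%N keys i))
  (fun i => gk (nth 0%N keys i)) M_gt0.
- by move=> i n; apply: ch_period.
- by move=> i; apply: ch_one.
- by move=> i; apply: ch_morph.
- by move=> i n; apply: ch_sign.
- move=> j; have [u [co_u uj ui]] := ch_dual (kmem j).
  exists u; split=> // i ij; apply: ui => //.
  by rewrite nth_uniq ?keys_uniq.
- by move=> i; apply: gk_val.
- have p0_k : p0 \in keys by rewrite !inE p0_s !orbT.
  have lt0 : (index p0 keys < size keys)%N by rewrite index_mem.
  by exists (Ordinal lt0); rewrite /= nth_index // gk_s.
move=> q [q_pr _ Hq]; have {}Hq k : k \in keys -> ch k q = gk k.
  move=> k_k; have ltk : (index k keys < size keys)%N by rewrite index_mem.
  by have := Hq (Ordinal ltk); rewrite /= nth_index.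
exists q; split=> //.
- have := Hq 4%N (mem_head _ _); rewrite /ch /gk /= /chi4.
  by case: eqP => // _; case: eqP.
- by have := Hq 8%N; rewrite !inE; apply.
move=> p p_s; rewrite -(s_key p_s) Hq ?gk_s //.
by rewrite !inE p_s !orbT.
Qed.

End Keys.

(** An auxiliary prime l, with the condition that q is not a square modulo l,
    provides the sign -1 required by [prime_with_characters]. *)
Theorem prime_with_symbols (s : seq nat) (e8 : int) (e : nat -> int) :
    uniq s -> {in s, forall p, prime p && odd p} ->
    e8 = 1 \/ e8 = -1 -> {in s, forall p, e p = 1 \/ e p = -1} ->
  exists q, [/\ prime q, (q %% 4 = 1)%N, chi8 q = e8 &
    {in s, forall p, legendre p q = e p}].
Proof.
move=> s_uniq s_pr e8_val e_val.
have [l lt_l l_pr] := prime_above (\sum_(p <- s) p + 2)%N.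
have l_odd : odd l by case: (even_prime l_pr) => // l2; lia.
have l_s : l \notin s.
  apply/negP => l_s; move: lt_l; rewrite (big_rem l) //=; lia.
pose e' p : int := if p == l then -1 else e p.
have [|p|p|||q [q_pr q4 q8 qs]] :=
    @prime_with_symbols_nontrivial (l :: s) _ _ e8 e' l e8_val.
- by rewrite /= l_s.
- by rewrite inE => /orP[/eqP->|/s_pr //]; rewrite l_pr.
- rewrite inE /e'; case: eqP => _; [by right|exact: e_val].
- exact: mem_head.
- by rewrite /e' eqxx.
exists q; split=> // p p_s; rewrite qs ?inE ?p_s ?orbT // /e'.
by case: eqP p_s l_s => // -> ->.
Qed.

(** * Sums of three squares *)

Definition sum3sq (n : int) : Prop :=
  exists x y z : int, n = x ^+ 2 + y ^+ 2 + z ^+ 2.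

Lemma eqz_crt (m1 m2 : nat) (x y : int) : coprime m1 m2 ->
  exists u : int, (m1 %| u - x)%Z /\ (m2 %| u - y)%Z.
Proof.
move=> co; exists (zchinese m1 m2 x y).
by rewrite -!eqz_mod_dvd; split; apply/eqP; [apply: zchinese_modl|apply: zchinese_modr].
Qed.

Lemma dvdz_sqr_sub (m : nat) (u x b : int) :
  (m %| u - x)%Z -> (m %| x ^+ 2 - b)%Z -> (m %| u ^+ 2 - b)%Z.
Proof.
move=> ux xb; have -> : u ^+ 2 - b = (u - x) * (u + x) + (x ^+ 2 - b) by ring.
by rewrite rpredD // dvdz_mulr.
Qed.

Lemma sqrt_mod_crt (m1 m2 : nat) (b : int) : coprime m1 m2 ->
    (exists x : int, (m1 %| x ^+ 2 - b)%Z) -> (exists x : int, (m2 %| x ^+ 2 - b)%Z) ->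
  exists x : int, ((m1 * m2)%N %| x ^+ 2 - b)%Z.
Proof.
move=> co [x xb] [y yb]; have [u [ux uy]] := eqz_crt x y co.
exists u; have := dvdz_sqr_sub ux xb; have := dvdz_sqr_sub uy yb.
by rewrite !dvdzE /= Gauss_dvd // => -> ->.
Qed.

Lemma sqrt_mod_prod (s : seq nat) (b : int) : uniq s -> {in s, forall p, prime p} ->
    (forall p : nat, p \in s -> exists x : int, (p %| x ^+ 2 - b)%Z) ->
  exists x : int, ((\prod_(p <- s) p)%N %| x ^+ 2 - b)%Z.
Proof.
elim: s => [|p s IH] /=; first by move=> _ _ _; exists 0; rewrite big_nil dvd1z.
move=> /andP[p_s s_uniq] s_pr sb; rewrite big_cons; apply: sqrt_mod_crt.
- have p_pr : prime p by apply: s_pr; rewrite mem_head.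
  rewrite coprime_prod_seq; apply/allP => r r_s.
  rewrite prime_coprime // dvdn_prime2 //; last by apply: s_pr; rewrite inE r_s orbT.
  by apply: contraNneq p_s => ->.
- by apply: sb; rewrite mem_head.
by apply: IH => // r r_s; [apply: s_pr | apply: sb]; rewrite inE r_s orbT.
Qed.

Lemma sqrt_mod2 (b : int) : exists x : int, (2%N %| x ^+ 2 - b)%Z.
Proof.
exists b; have -> : b ^+ 2 - b = b * (b - 1) by ring.
rewrite dvdzE abszM Euclid_dvdM // -!dvdzE; lia.
Qed.

Definition squarefree n := forall p, prime p -> ~~ (p ^ 2 %| n)%N.

Lemma squarefree_prod n : (0 < n)%N -> squarefree n -> n = (\prod_(p <- primes n) p)%N.
Proof.
move=> n_gt0 sqf; rewrite {1}(prod_prime_decomp n_gt0) prime_decompE big_map /=.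
rewrite !big_seq; apply: eq_bigr => p; rewrite mem_primes => /and3P[p_pr _ p_n].
have := sqf p p_pr; rewrite pfactor_dvdn // -ltnNge ltnS => le1.
have : (0 < logn p n)%N by rewrite logn_gt0 mem_primes p_pr n_gt0.
by move: (logn p n) le1 => [|[|]] //; rewrite expn1.
Qed.

Lemma chi4_prod (s : seq nat) : chi4 (\prod_(p <- s) p) = \prod_(p <- s) chi4 p.
Proof. by elim/big_rec2: _ => // p y x _ <-; rewrite chi4M. Qed.

Lemma chi8_prod (s : seq nat) : chi8 (\prod_(p <- s) p) = \prod_(p <- s) chi8 p.
Proof. by elim/big_rec2: _ => // p y x _ <-; rewrite chi8M. Qed.

Lemma legendre_prod q (s : seq nat) : prime q -> odd q ->
  legendre q (\prod_(p <- s) p)%N = \prod_(p <- s) legendre q p.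
Proof.
move=> q_pr q_odd; elim/big_rec2: _ => [|p y x _ <-]; first exact: legendre1.
by rewrite PoszM legendreM.
Qed.

(** Replacing a by a sum of two rational squares in z^2 + a u^2 = n v^2
    exhibits n as a sum of three rational squares. *)
Lemma sum3sq_of_ternary (n a : nat) (r s t x y : int) :
    (0 < a)%N -> (0 < n)%N -> coprime a n ->
    (n %| r ^+ 2 + a%:Z)%Z -> (a %| s ^+ 2 - n%:Z)%Z ->
    t != 0 -> a%:Z * t ^+ 2 = x ^+ 2 + y ^+ 2 ->
  sum3sq n.
Proof.
move=> a0 n0 co nr sa t0 at2.
have [z [u [v [v0 zuv]]]] := ternary_zero a0 n0 co nr sa.
apply: (@aubry n (z * t) (u * x) (u * y) `|v * t|).
  by rewrite normr_gt0 mulf_neq0.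
rewrite real_normK ?num_real // exprMn mulrA -zuv mulrDl.
have -> : a%:Z * u ^+ 2 * t ^+ 2 = u ^+ 2 * (a%:Z * t ^+ 2) by ring.
by rewrite at2; ring.
Qed.

(** A rational form of Fermat's theorem on two squares: [ternary_zero] with
    a = 1. *)
Lemma prime_sum2sq q : prime q -> (q %% 4 = 1)%N ->
  exists t x y : int, t != 0 /\ q%:Z * t ^+ 2 = x ^+ 2 + y ^+ 2.
Proof.
move=> q_pr q4; have q_odd : odd q by lia.
have [|r rq] := @legendre_sqr_root q q_pr q_odd (-1).
  by rewrite legendreN1 // /chi4 q4.
rewrite opprK in rq.
have [z [u [t [t0 H]]]] := ternary_zero (isT : 0 < 1)%N (prime_gt0 q_pr)
  (coprime1n q) rq (dvd1z (0 ^+ 2 - q%:Z)).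
by exists t, z, u; split=> //; rewrite -H mul1r.
Qed.

(** Let N be the odd part of n and let p run over its prime factors.  The
    conditions are chosen so that -a is a square modulo every p: (q / p) is
    (-1 / p) when a = q, and (-2 / p) when a = 2q.  By reciprocity (N / q) is
    the product of the (q / p), which is [chi4 N], respectively
    [chi4 N * chi8 N], and this is 1 when n = 1 mod 4 or n = 3 mod 8.  When
    n = 2N, the condition chi8 q = chi4 N makes (2N / q) equal to 1. *)
Lemma sum3sq_squarefree n : squarefree n ->
  (n %% 4 = 1 \/ n %% 4 = 2 \/ n %% 8 = 3)%N -> sum3sq n.
Proof.
move=> sqf n_mod; have n_gt0 : (0 < n)%N by case: n n_mod {sqf} => // -[|[]].
have [e [N [nE N_odd]]] : exists (e : bool) N, n = (if e then N else 2 * N)%N /\ odd N.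
  exists (odd n), (if odd n then n else n./2).
  by clear sqf; case: ifP => n_odd; rewrite ?n_odd; split; lia.
have N_gt0 : (0 < N)%N by apply: odd_gt0.
have N_sqf : squarefree N.
  move=> p p_pr; apply: contra (sqf p p_pr) => h; rewrite nE.
  by case: (e); rewrite ?dvdn_mull.
pose s := primes N; have NE := squarefree_prod N_gt0 N_sqf.
have s_pr : {in s, forall p, prime p && odd p}.
  move=> p; rewrite mem_primes => /and3P[p_pr _ p_N]; rewrite p_pr /=.
  exact: dvdn_odd p_N N_odd.
pose c3 := (n %% 8 == 3)%N.
pose eps p : int := if c3 then chi4 p * chi8 p else chi4 p.
pose e8 : int := if e then 1 else chi4 N.
have [|p|q [q_pr q4 q8 qs]] := @prime_with_symbols s e8 eps (primes_uniq _) s_pr.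
- by rewrite /e8; case: (e); [left | apply: chi4_odd].
- move=> /s_pr/andP[_ p_odd]; rewrite /eps; case: ifP => _; last exact: chi4_odd.
  by case: (chi4_odd p_odd) => ->; case: (chi8_odd p_odd) => ->; [left|right|right|left].
have q_odd : odd q by lia.
have eps_val p : p \in s -> eps p != 0.
  move=> /s_pr/andP[_ p_odd]; rewrite /eps.
  by case: (chi4_odd p_odd) => ->; case: (chi8_odd p_odd) => ->; case: ifP.
have p_neq_q p : p \in s -> p != q.
  move=> p_s; have /andP[p_pr p_odd] := s_pr p p_s.
  apply: contraNneq (eps_val p p_s) => p_q; rewrite -qs // p_q.
  by rewrite legendre_eq0 // dvdzz.
have lqN : legendre q N = \prod_(p <- s) eps p.
  rewrite {1}NE legendre_prod // -/s !big_seq; apply: eq_bigr => p p_s.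
  have /andP[p_pr p_odd] := s_pr p p_s.
  by rewrite -qs // (quadratic_reciprocity p_pr p_odd q_pr q_odd (p_neq_q p p_s) q4).
have [c3E|c3N] := boolP c3.
  (* n = 3 mod 8, with 2q in the role of a *)
  have n8 : (n %% 8 = 3)%N by apply/eqP.
  have eN : N = n by rewrite nE; case: e nE {e8 q8} => //; lia.
  have lqn : legendre q n = 1.
    rewrite -eN lqN /eps c3E big_split /= -chi4_prod -chi8_prod -NE eN.
    have n4 : (n %% 4 = 3)%N by lia.
    by rewrite /chi4 /chi8 n4 n8.
  have [r nr] : exists r : int, (n %| r ^+ 2 - - (2 * q)%N%:Z)%Z.
    rewrite -eN NE; apply: (sqrt_mod_prod (primes_uniq _)) => [p /s_pr/andP[] //|p p_s].
    have /andP[p_pr p_odd] := s_pr p p_s.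
    apply: legendre_sqr_root => //.
    rewrite -mulN1r PoszM !legendreM // qs // legendreN1 // legendre2 // /eps c3E.
    by case: (chi4_odd p_odd) => ->; case: (chi8_odd p_odd) => ->.
  have [x nx] : exists x : int, ((2 * q)%N %| x ^+ 2 - n%:Z)%Z.
    apply: sqrt_mod_crt; first by rewrite coprime2n.
      exact: sqrt_mod2.
    exact: legendre_sqr_root.
  have [t [y [z [t0 qt]]]] := prime_sum2sq q_pr q4.
  apply: (@sum3sq_of_ternary n (2 * q) r x t (y + z) (y - z)) => //.
  - by rewrite muln_gt0 (prime_gt0 q_pr).
  - rewrite coprimeMl coprime2n prime_coprime //; apply/andP; split; first by rewrite -eN.
    have := legendre_eq0 q_pr q_odd n.
    by rewrite lqn dvdzE /= => <-.
  - by rewrite opprK in nr.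
  - by rewrite PoszM -mulrA qt; ring.
(* n = 1 or 2 mod 4, with q in the role of a *)
have lqn : legendre q n = 1.
  have lqN4 : legendre q N = chi4 N by rewrite lqN /eps (negPf c3N) -chi4_prod -NE.
  rewrite nE; case: e nE @e8 q8 => nE e8 q8.
    by rewrite lqN4 /chi4; have -> : (N %% 4 = 1)%N by move: c3N; rewrite /c3; lia.
  rewrite PoszM legendreM // legendre2 // q8 lqN4 /e8.
  by case: (chi4_odd N_odd) => ->.
have [r nr] : exists r : int, (n %| r ^+ 2 - - q%:Z)%Z.
  have [r Nr] : exists r : int, (N %| r ^+ 2 - - q%:Z)%Z.
    rewrite NE; apply: (sqrt_mod_prod (primes_uniq _)) => [p /s_pr/andP[] //|p p_s].
    have /andP[p_pr p_odd] := s_pr p p_s.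
    apply: legendre_sqr_root => //.
    rewrite -mulN1r legendreM // qs // legendreN1 // /eps (negPf c3N).
    by case: (chi4_odd p_odd) => ->.
  rewrite nE; case: (e); first by exists r.
  apply: sqrt_mod_crt; [by rewrite coprime2n | exact: sqrt_mod2 | by exists r].
have [x nx] := legendre_sqr_root q_pr q_odd lqn.
have [t [y [z [t0 qt]]]] := prime_sum2sq q_pr q4.
apply: (@sum3sq_of_ternary n q r x t y z) => //.
- exact: prime_gt0.
- rewrite prime_coprime //; have := legendre_eq0 q_pr q_odd n.
  by rewrite lqn dvdzE /= => <-.
by rewrite opprK in nr.
Qed.

(** Dividing n by the square of an odd prime does not change n modulo 8. *)
Theorem three_squares n : (n %% 4 = 1 \/ n %% 4 = 2 \/ n %% 8 = 3)%N -> sum3sq n.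
Proof.
have [k] := ubnP n; elim: k n => // k IH n lt_nk n_mod.
have n_gt0 : (0 < n)%N by case: n n_mod {lt_nk} => // -[|[]].
have [sqf|] := boolP [forall p : 'I_n.+1, prime p ==> ~~ (p ^ 2 %| n)%N].
  apply: sum3sq_squarefree => // p p_pr; have [lt_pn|lt_np] := ltnP p n.+1.
    by have /forallP /(_ (Ordinal lt_pn)) /implyP := sqf; apply.
  by apply: contraL lt_np => /dvdn_leq; rewrite -ltnNge ltnS => /(_ n_gt0); nia.
rewrite negb_forall => /existsP[[p _]] /=; rewrite negb_imply negbK => /andP[p_pr p2_n].
have p_gt1 := prime_gt1 p_pr; case/dvdnP: p2_n => m def_n.
have p_odd : odd p.
  case: (even_prime p_pr) => // p2; move: n_mod; rewrite def_n p2; lia.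
have p8 : (p ^ 2 %% 8 = 1)%N.
  have : (p %% 8 = 1 \/ p %% 8 = 3 \/ p %% 8 = 5 \/ p %% 8 = 7)%N by lia.
  by rewrite -modnXm => -[->|[->|[->|->]]].
have m8 : (n %% 8 = m %% 8)%N by rewrite def_n -modnMmr p8 muln1.
have [||x [y [z mE]]] := IH m.
- by rewrite -ltnS; apply: leq_trans lt_nk; rewrite ltnS def_n; nia.
- by move: n_mod m8; clear; lia.
exists (p%:Z * x), (p%:Z * y), (p%:Z * z).
by rewrite def_n PoszM mE -natz natrX natz; ring.
Qed.

(** * Representations with denominator 3 and small values *)

(** Everything over the denominator 3, so that congruences and the finite search
    stay in nat: a, b and z are the numerators, and t^2 is the integer x + y. *)
Definition thirds_rep (m : nat) : Prop := exists a b z w t : nat,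
  (9 * m = a ^ 2 + b ^ 2 + z ^ 2 + 9 * w ^ 2)%N /\ (a + b = 3 * t ^ 2)%N.

(** Scaling x, y, z, w by 4 turns x + y = t^2 into x + y = (2t)^2. *)
Lemma thirds_rep16 m : thirds_rep m -> thirds_rep (16 * m).
Proof.
move=> [a [b [z [w [t [H1 H2]]]]]].
by exists (4 * a)%N, (4 * b)%N, (4 * z)%N, (4 * w)%N, (2 * t)%N; split; lia.
Qed.

Lemma thirds_rep_scale c m a b z w t : (c = 1 \/ c = 3)%N ->
    (c ^ 2 * m = a ^ 2 + b ^ 2 + z ^ 2 + c ^ 2 * w ^ 2)%N -> (a + b = c * t ^ 2)%N ->
  thirds_rep m.
Proof.
have sq3 : (3 ^ 2 = 9)%N by [].
case=> ->; rewrite ?exp1n ?sq3 ?mul1n => H1 H2; last by exists a, b, z, w, t.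
exists (3 * a)%N, (3 * b)%N, (3 * z)%N, w, t.
by rewrite !expnMn sq3 -!mulnDr -H1 H2.
Qed.

(** A loop that stops at the first success also under call by value. *)
Fixpoint exists_from (p : nat -> bool) (k n : nat) : bool :=
  if n is n'.+1 then if p k then true else exists_from p k.+1 n' else false.

Lemma exists_fromP p k n : exists_from p k n -> exists2 i, (i < k + n)%N & p i.
Proof.
elim: n k => //= n IH k; case: ifP => [pk _|_ /IH[i lt_i pi]].
  by exists k; rewrite // -addSnnS leq_addr.
by exists i; rewrite // -addSnnS.
Qed.

(** Representations with x + y = t^2 over the denominator c, for t <= 12.  By
    symmetry, the numerator of x is at most half of c t^2. *)
Definition search (c m : N) : bool :=
  let n := (c * c * m)%num in
  exists_from (fun i : nat => let t := N.of_nat i in let s := (c * (t * t))%num in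
    exists_from (fun j : nat => let a := N.of_nat j in let b := (s - a)%num in
      let v := (a * a + b * b)%num in
      if N.leb v n then
        exists_from (fun k : nat => let w := N.of_nat k in
          let u := (v + c * c * (w * w))%num in
          if N.leb u n then
            let z := N.sqrt (n - u) in N.eqb (u + z * z)%num n
          else false)
        0 (N.to_nat (N.sqrt m)).+1
      else false)
    0 (N.to_nat (N.div2 s)).+1)
  0 13.

Lemma search_sound c m : (c = 1 \/ c = 3)%num -> search c m -> thirds_rep (N.to_nat m).
Proof.
move=> c13; rewrite /search => /exists_fromP[i _]; lazy beta zeta => /exists_fromP[j].
rewrite add0n => lt_j; case: ifP => // _ /exists_fromP[k _].
case: ifP => // _ /N.eqb_eq; lazy beta zeta.
move: (N.sqrt _) => z H.
have le_j : (j <= N.to_nat c * i ^ 2)%N.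
  have := N.div2_decr (c * (N.of_nat i * N.of_nat i)) (c * (N.of_nat i * N.of_nat i)).
  by clear c13 H; nia.
apply: (@thirds_rep_scale (N.to_nat c) _ j (N.to_nat c * i ^ 2 - j) (N.to_nat z) k i).
- by case: c13 => ->; [left | right].
- by clear c13; nia.
by rewrite subnKC.
Qed.

(** Denominator 1 is tried first: denominator 3 is called for by six values
    only. *)
Definition small_check (a d : N) (len : nat) : bool :=
  all (fun i : nat => let m := (a + d * N.of_nat i)%num in
    if search 1 m then true else search 3 m)
      (iota 0 len).

Lemma small_checkP a d len (m i : nat) : small_check a d len ->
  (i < len)%N -> m = (N.to_nat a + N.to_nat d * i)%N -> thirds_rep m.
Proof.
move=> /allP H lt_i ->; have := H i; rewrite mem_iota lt_i => /(_ isT); lazy beta zeta.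
set M := (a + _)%num; have -> : (N.to_nat a + N.to_nat d * i)%N = N.to_nat M by lia.
by case: ifP => [h _|_]; [apply: (@search_sound 1) | apply: (@search_sound 3)] => //;
  [left | right].
Qed.

Lemma small_odd : small_check 1 2 648. Proof. by vm_cast_no_check (erefl true). Qed.
Lemma small_2mod4 : small_check 2 4 313. Proof. by vm_cast_no_check (erefl true). Qed.
Lemma small_4mod8 : small_check 4 8 81. Proof. by vm_cast_no_check (erefl true). Qed.
Lemma small_8mod32 : small_check 8 32 324. Proof. by vm_cast_no_check (erefl true). Qed.
Lemma small_56mod64 : small_check 56 64 79. Proof. by vm_cast_no_check (erefl true). Qed.
Lemma small_24mod64 : small_check 24 64 11. Proof. by vm_cast_no_check (erefl true). Qed.

(** * From three squares to x + y = t^2 *)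

Lemma dvd2_sqrB (x y : int) : (2 %| x ^+ 2 - y ^+ 2)%Z -> (2 %| x - y)%Z.
Proof.
rewrite subr_sqr dvdzE abszM Euclid_dvdM // -!dvdzE => /orP[//|h].
by rewrite (_ : x - y = x + y - 2 * y) ?rpredB ?dvdz_mulr //; ring.
Qed.

(** Take x = (t^2 + A) / 2, y = (t^2 - A) / 2, z = |B + C| / 2 and
    w = |B - C| / 2.  The parity of A is forced by that of B + C. *)
Lemma thirds_rep_of_decomp (m t : nat) (A B C : int) :
    2 * m%:Z = t%:Z ^+ 4 + A ^+ 2 + B ^+ 2 + C ^+ 2 ->
    (2 %| B - C)%Z -> A ^+ 2 <= t%:Z ^+ 4 ->
  thirds_rep m.
Proof.
move=> H BC At.
have /dvdzP[k Ak] : (2 %| t%:Z ^+ 2 - A)%Z.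
  apply: dvd2_sqrB; case/dvdzP: BC => l Bl.
  have -> : (t%:Z ^+ 2) ^+ 2 - A ^+ 2 =
      2 * (t%:Z ^+ 4 - m%:Z + B * C + 2 * l ^+ 2) + ((B - C) ^+ 2 - (l * 2) ^+ 2)
      + (2 * m%:Z - (t%:Z ^+ 4 + A ^+ 2 + B ^+ 2 + C ^+ 2)) by ring.
  by rewrite Bl H !subrr !addr0 dvdz_mulr.
case/dvdzP: BC => l Bl.
have {Ak}AE : A = t%:Z ^+ 2 - 2 * k by rewrite mulrC -Ak; ring.
have {Bl}CE : C = B - 2 * l by rewrite mulrC -Bl; ring.
have t2_ge0 := sqr_ge0 t%:Z.
have : `|A| <= t%:Z ^+ 2.
  by rewrite -(ler_pXn2r (isT : 0 < 2)%N) ?nnegrE // real_normK ?num_real // -exprM.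
rewrite AE ler_norml => /andP[k1 k2].
have k_ge0 : 0 <= k by clear -k1 k2; lia.
have k_le : k <= t%:Z ^+ 2 by clear -k1 k2; lia.
have mE : m%:Z = (t%:Z ^+ 2 - k) ^+ 2 + k ^+ 2 + (B - l) ^+ 2 + l ^+ 2.
  apply: (mulfI (isT : (2 : int) != 0)); rewrite H AE CE; ring.
apply: (@thirds_rep_scale 1 m `|t%:Z ^+ 2 - k|%N `|k|%N `|B - l|%N `|l|%N t).
- by left.
- apply/eqP; rewrite -eqz_nat exp1n !mul1n !PoszD mE; apply/eqP.
  have sqE (x : int) : (`|x| ^ 2)%N%:Z = x ^+ 2.
    by rewrite -[LHS]natz natrX natz abszE real_normK ?num_real.
  by rewrite !sqE.
apply/eqP; rewrite -eqz_nat mul1n PoszD !gez0_abs ?subr_ge0 // subrK.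
by rewrite -[Posz (t ^ 2)]natz natrX natz.
Qed.

Lemma two_same_parity (x y z : int) :
  [\/ (2 %| y - z)%Z, (2 %| x - z)%Z | (2 %| x - y)%Z].
Proof.
have h : [|| (2 %| y - z)%Z, (2 %| x - z)%Z | (2 %| x - y)%Z] by lia.
by case/or3P: h => h; [constructor 1 | constructor 2 | constructor 3].
Qed.

(** Two of the three integers have the same parity, and the third has square
    at most 2m - t^4 <= t^4. *)
Lemma thirds_rep_large_t (m t : nat) : (m <= t ^ 4)%N -> (t ^ 4 <= 2 * m)%N ->
  sum3sq (2 * m - t ^ 4)%N -> thirds_rep m.
Proof.
move=> le_mt le_tm [x [y [z nE]]].
have t4 : (t ^ 4)%N%:Z = t%:Z ^+ 4 by rewrite -[LHS]natz natrX natz.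
rewrite -subzn // t4 PoszM in nE.
have nt : 2 * m%:Z - t%:Z ^+ 4 <= t%:Z ^+ 4.
  by rewrite -t4; clear -le_mt; lia.
have [x0 y0 z0] := And3 (sqr_ge0 x) (sqr_ge0 y) (sqr_ge0 z).
have {}nE : 2 * m%:Z = t%:Z ^+ 4 + (x ^+ 2 + y ^+ 2 + z ^+ 2).
  by rewrite -nE; ring.
have small : x ^+ 2 + y ^+ 2 + z ^+ 2 <= t%:Z ^+ 4.
  by move: nt; rewrite nE; clear; lia.
case: (two_same_parity x y z) => par.
- by apply: (@thirds_rep_of_decomp m t x y z); rewrite ?nE //; [ring|clear -small y0 z0; lia].
- by apply: (@thirds_rep_of_decomp m t y x z); rewrite ?nE //; [ring|clear -small x0 z0; lia].
by apply: (@thirds_rep_of_decomp m t z x y); rewrite ?nE //; [ring|clear -small x0 y0; lia].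
Qed.

(** Here any of the three may play the role of A, and they cannot all have
    squares greater than t^4, since 2m - t^4 <= 3 t^4. *)
Lemma thirds_rep_same_parity (m t : nat) (x y z : int) :
    (m <= 2 * t ^ 4)%N -> (2 * m)%N = (t ^ 4)%N%:Z + (x ^+ 2 + y ^+ 2 + z ^+ 2) :> int ->
    (2 %| x - y)%Z -> (2 %| x - z)%Z -> thirds_rep m.
Proof.
move=> le_mt nE xy xz.
have t4 : (t ^ 4)%N%:Z = t%:Z ^+ 4 by rewrite -[LHS]natz natrX natz.
have small : x ^+ 2 + y ^+ 2 + z ^+ 2 <= 3 * t%:Z ^+ 4.
  by rewrite -t4; clear -nE le_mt; lia.
rewrite t4 PoszM in nE.
have yz : (2 %| y - z)%Z by clear -xy xz; lia.
have [xt|tx] := leP (x ^+ 2) (t%:Z ^+ 4).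
  by apply: (@thirds_rep_of_decomp m t x y z) => //; rewrite nE; ring.
have [yt|ty] := leP (y ^+ 2) (t%:Z ^+ 4).
  by apply: (@thirds_rep_of_decomp m t y x z) => //; rewrite nE; ring.
apply: (@thirds_rep_of_decomp m t z x y) => //; first by rewrite nE; ring.
by clear -small tx ty; lia.
Qed.

(** Brackets k between consecutive values of f.  With [f j.+1 <= 4 * f j] for
    j >= j0, it follows that f j <= k <= 4 * f j for some j. *)
Lemma bracket (f : nat -> nat) j0 k : (f j0 <= k)%N -> (forall j, j <= f j)%N ->
  exists j, [/\ (j0 <= j)%N, (f j <= k)%N & (k < f j.+1)%N].
Proof.
move=> f0 fj; pose P j := (j0 <= j)%N && (f j <= k)%N.
have exP : exists j, P j by exists j0; rewrite /P leqnn.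
have bP j : P j -> (j <= k)%N by case/andP => _; apply: leq_trans.
case: (ex_maxnP exP bP) => j /andP[le_j le_fj] max_j; exists j; split=> //.
rewrite ltnNge; apply/negP => le_k; have := max_j j.+1; rewrite /P le_k andbT.
by rewrite (leqW le_j) ltnn => /(_ isT).
Qed.

Lemma expn4_ge j : (j <= j ^ 4)%N.
Proof. by case: j => // j; rewrite -{1}(expn1 j.+1) leq_pexp2l. Qed.

Lemma ratio2 j : (6 <= j -> j.+1 ^ 4 <= 2 * j ^ 4)%N.
Proof. by move=> j6; rewrite -(subnKC j6); move: (j - 6)%N => u; nia. Qed.

Lemma ratio4 j : (3 <= j -> j.+1 ^ 4 <= 4 * j ^ 4)%N.
Proof. by move=> j3; rewrite -(subnKC j3); move: (j - 3)%N => u; nia. Qed.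

Lemma ratio4_odd j : (2 <= j -> (2 * j.+1).+1 ^ 4 <= 4 * (2 * j).+1 ^ 4)%N.
Proof. by move=> j2; rewrite -(subnKC j2); move: (j - 2)%N => u; nia. Qed.

(** * The choice of t *)

Lemma pow4_mod16 t : (t ^ 4 %% 16 = odd t)%N.
Proof.
rewrite -modnXm -(odd_mod t (erefl : odd 16 = false)).
by have := ltn_pmod t (isT : 0 < 16)%N; move: (t %% 16)%N; do 16 case=> //.
Qed.

(** Squares are 0 or 1 modulo 4. *)
Lemma all_odd_of_3mod4 (n : nat) (x y z : int) : (n %% 4 = 3)%N ->
    n%:Z = x ^+ 2 + y ^+ 2 + z ^+ 2 -> (2 %| x - y)%Z /\ (2 %| x - z)%Z.
Proof.
move=> n4 nE.
have sq (u : int) : exists e v : int,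
    [/\ e = 0 \/ e = 1, u = 2 * v + e & u ^+ 2 = 4 * (v ^+ 2 + v * e) + e].
  have [e [v [e01 uE]]] : exists e v : int, (e = 0 \/ e = 1) /\ u = 2 * v + e.
    by exists (u %% 2)%Z, (u %/ 2)%Z; split; lia.
  exists e, v; split=> //; rewrite uE; case: e01 => ->; ring.
have [e1 [v1 [h1 x1 x2]]] := sq x; have [e2 [v2 [h2 y1 y2]]] := sq y.
have [e3 [v3 [h3 z1 z2]]] := sq z.
rewrite {}x2 {}y2 {}z2 in nE; rewrite {}x1 {}y1 {}z1.
move: (v1 ^+ 2 + _) (v2 ^+ 2 + _) (v3 ^+ 2 + _) nE => w1 w2 w3 nE.
by clear sq; lia.
Qed.

(** All t are admissible: 2m - t^4 is 2 modulo 4 if t is even and 1 modulo 4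
    if t is odd. *)
Lemma thirds_rep_odd m : odd m -> thirds_rep m.
Proof.
move=> m_odd; have [lt_m|le_m] := ltnP m 1296.
  by apply: (small_checkP (i := m./2) small_odd); lia.
have [j [j6 le_jm lt_mj]] := @bracket (fun j => j ^ 4)%N 6 m le_m expn4_ge.
have t2 : (j.+1 ^ 4 <= 2 * m)%N.
  by apply: leq_trans (ratio2 j6) _; rewrite leq_mul2l le_jm.
apply: (thirds_rep_large_t (ltnW lt_mj) t2); apply: three_squares.
have := pow4_mod16 j.+1; move: (j.+1 ^ 4)%N t2 => T t2.
by case: odd; clear -m_odd t2; lia.
Qed.

(** For odd t the number 2m - t^4 is 3 modulo 8, and its three squares are
    odd. *)
Lemma thirds_rep_2mod4 m : (m %% 4 = 2)%N -> thirds_rep m.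
Proof.
move=> m4; pose k := m./2; have mE : m = (2 * k)%N by rewrite /k; lia.
have [lt_k|le_k] := ltnP k 625.
  by apply: (small_checkP (i := m %/ 4) small_2mod4); lia.
have [|j [j2 le_jk lt_kj]] := @bracket (fun j => (2 * j).+1 ^ 4)%N 2 k le_k.
  by move=> j; apply: leq_trans (expn4_ge _); lia.
have kt := leq_trans (ratio4_odd j2) (leq_mul (leqnn 4) le_jk).
have := pow4_mod16 (2 * j.+1).+1; rewrite (_ : odd _ = true); last by lia.
move: (2 * j.+1).+1 kt lt_kj => t kt lt_kt t16.
have t2m : (t ^ 4 <= 2 * m)%N by clear -kt mE; lia.
have n8 : ((2 * m - t ^ 4) %% 8 = 3)%N by clear -m4 t16 t2m; lia.
have [|x [y [z nE]]] := @three_squares (2 * m - t ^ 4); first by right; right.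
have [|xy xz] := all_odd_of_3mod4 _ nE; first by clear -n8; lia.
apply: (@thirds_rep_same_parity m t x y z) => //; first by clear -lt_kt mE; lia.
by rewrite -nE; clear -t2m; lia.
Qed.

Lemma thirds_rep_even (m t n c : nat) : (m <= 2 * t ^ 4)%N ->
    (2 * m = t ^ 4 + (2 * c) ^ 2 * n)%N -> sum3sq n -> thirds_rep m.
Proof.
move=> le_mt mE [x [y [z nE]]].
have even (u v : int) : (2 %| 2 * c%:Z * u - 2 * c%:Z * v)%Z.
  by rewrite -!mulrA -mulrBr dvdz_mulr.
apply: (@thirds_rep_same_parity m t (2 * c%:Z * x) (2 * c%:Z * y) (2 * c%:Z * z)) => //.
rewrite mE PoszD PoszM nE -[Posz ((2 * c) ^ 2)]natz natrX natz PoszM; ring.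
Qed.

(** With m = 4k and t = 2j, 2m - t^4 is 4 (2k - 4 j^4), where the second
    factor is 2 modulo 4. *)
Lemma thirds_rep_4mod8 m : (m %% 8 = 4)%N -> thirds_rep m.
Proof.
move=> m8; pose k := (m %/ 4)%N; have mE : m = (4 * k)%N by rewrite /k; lia.
have [lt_k|le_k] := ltnP k 162.
  by apply: (small_checkP (i := m %/ 8) small_4mod8); lia.
have [|j [j3 le_jk lt_kj]] := @bracket (fun j => 2 * j ^ 4)%N 3 k le_k.
  by move=> j; have := expn4_ge j; lia.
have r := ratio4 j3; have t4 : ((2 * j) ^ 4 = 16 * j ^ 4)%N by rewrite expnMn.
apply: (@thirds_rep_even m (2 * j) (2 * k - 4 * j ^ 4) 1).
- by rewrite t4; clear -r lt_kj mE; lia.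
- by rewrite t4; clear -le_jk mE; lia.
by apply: three_squares; clear -m8 mE le_jk; lia.
Qed.

(** With t = 2s, 2m - t^4 is 16 (k - s^4). *)
Lemma thirds_rep_8k k s : (s ^ 4 <= k <= 4 * s ^ 4)%N -> sum3sq (k - s ^ 4)%N ->
  thirds_rep (8 * k).
Proof.
move=> /andP[le_sk le_ks]; have t4 : ((2 * s) ^ 4 = 16 * s ^ 4)%N by rewrite expnMn.
apply: (@thirds_rep_even _ (2 * s) _ 2); rewrite t4; first by clear -le_ks; lia.
by clear -le_sk; lia.
Qed.

(** The parity of s in [thirds_rep_8k] is chosen so that k - s^4 is a sum of
    three squares: s even if k = 1 mod 4, s odd if k = 7 mod 8; if k = 3 mod 8
    both parities will do. *)
Lemma thirds_rep_8mod16 m : (m %% 16 = 8)%N -> thirds_rep m.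
Proof.
move=> m16; pose k := (m %/ 8)%N; have mE : m = (8 * k)%N by rewrite /k; lia.
have : (k %% 4 = 1 \/ k %% 8 = 3 \/ k %% 8 = 7)%N by lia.
clearbody k; case=> [k4|[k8|k8]].
- have [lt_k|le_k] := ltnP k 1296.
    by apply: (small_checkP (i := k %/ 4) small_8mod32); lia.
  have [|j [j3 le_jk lt_kj]] := @bracket (fun j => (2 * j) ^ 4)%N 3 k le_k.
    by move=> j; apply: leq_trans (expn4_ge _); lia.
  have r := ratio4 j3; rewrite mE.
  have s16 := pow4_mod16 (2 * j); rewrite oddM /= in s16.
  apply: (@thirds_rep_8k k (2 * j)); first rewrite le_jk /=.
    by move: lt_kj; rewrite !expnMn; clear -r; lia.
  by apply: three_squares; move: le_jk s16 k4; clear; move: (_ ^ 4)%N => *; lia.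
- have [lt_k|le_k] := ltnP k 81.
    by apply: (small_checkP (i := k %/ 8) small_24mod64); lia.
  have [j [j3 le_jk lt_kj]] := @bracket (fun j => j ^ 4)%N 3 k le_k expn4_ge.
  have r := ratio4 j3; rewrite mE; have s16 := pow4_mod16 j.
  apply: (@thirds_rep_8k k j); first by rewrite le_jk (leq_trans (ltnW lt_kj)).
  apply: three_squares; move: (j ^ 4)%N s16 le_jk => T; case: odd; clear -k8; lia.
have [lt_k|le_k] := ltnP k 625.
  by apply: (small_checkP (i := k %/ 8) small_56mod64); lia.
have [|j [j2 le_jk lt_kj]] := @bracket (fun j => (2 * j).+1 ^ 4)%N 2 k le_k.
  by move=> j; apply: leq_trans (expn4_ge _); lia.
have r := ratio4_odd j2; rewrite mE.
have s16 := pow4_mod16 (2 * j).+1; rewrite /= oddM /= in s16.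
apply: (@thirds_rep_8k k (2 * j).+1); first by rewrite le_jk (leq_trans (ltnW lt_kj)).
by apply: three_squares; move: le_jk s16 k8; clear; move: (_ ^ 4)%N => *; lia.
Qed.

Lemma thirds_rep_all m : thirds_rep m.
Proof.
have [n] := ubnP m; elim: n m => // n IH m lt_mn.
have [->|m_gt0] := posnP m; first by exists 0, 0, 0, 0, 0.
have [m0|[m1|[m2|[m4|m8]]]] :
    (m %% 16 = 0 \/ odd m \/ m %% 4 = 2 \/ m %% 8 = 4 \/ m %% 16 = 8)%N.
  by clear -m_gt0; lia.
- have -> : m = (16 * (m %/ 16))%N by clear -m0; lia.
  by apply/thirds_rep16/IH; clear -m0 m_gt0 lt_mn; lia.
- exact: thirds_rep_odd.
- exact: thirds_rep_2mod4.
- exact: thirds_rep_4mod8.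
- exact: thirds_rep_8mod16.
Qed.

Theorem theorem1p2 (m : nat) :
  exists (x y z : rat) (w : nat),
    [/\ in_nat_thirds x, in_nat_thirds y, in_nat_thirds z,
        m%:R = x ^+ 2 + y ^+ 2 + z ^+ 2 + w%:R ^+ 2
      & is_int_square (x + y)].
Proof.
have [a [b [c [w [t [mE abE]]]]]] := thirds_rep_all m.
have three0 : (3%:R : rat) != 0 by [].
exists (a%:R / 3%:R), (b%:R / 3%:R), (c%:R / 3%:R), w; split.
- by exists a.
- by exists b.
- by exists c.
- have nine0 : (9%:R : rat) != 0 by [].
  by apply: (mulfI nine0); rewrite -natrM mE !natrD natrM !natrX; field.
exists t%:Z; rewrite -mulrDl -natrD abE natrM natrX rmorphXn /= mulrAC mulfV //.
by rewrite mul1r.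
Qed.
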